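(* Let $X$ be a Banach space. A multifunction $\Gamma:[0,1]\to cb(X)$ is variationally McShane integrable if and only if it is variationally Henstock integrable and the interval variation of its (variational) Henstock integral $\Phi_\Gamma$ is finite, i.e. $\widetilde{\Phi}_\Gamma([0,1])<\infty$.
   Context: $cb(X)$ is the family of nonempty closed convex bounded subsets of $X$, $d_H$ the Hausdorff metric on it, $\|C\|_h=d_H(C,\{0\})=\sup_{x\in C}\|x\|$. $\mathcal{I}$ is the family of closed subintervals of $[0,1]$, $\lambda$ is Lebesgue measure. A gauge is a function $\delta:[0,1]\to(0,\infty)$. A partition of $[0,1]$ is a finite collection $\{(I_1,t_1),\dots,(I_p,t_p)\}$ where $I_1,\dots,I_p$ are non-overlapping closed intervals with union $[0,1]$ and $t_i\in[0,1]$; it is a Perron partition if $t_i\in I_i$ for all $i$. It is $\delta$-fine if $I_i\subset[t_i-\delta(t_i),t_i+\delta(t_i)]$ for all $i$. $\Gamma:[0,1]\to cb(X)$ is variationally Henstock (respectively variationally McShane) integrable if there is an additive interval multimeasure $\Phi_\Gamma:\mathcal{I}\to cb(X)$ (its integral; additivity is with respect to the closure of the Minkowski sum) such that for every $\varepsilon>0$ there is a gauge $\delta$ with $$\sum_{i=1}^p d_H\big(\Phi_\Gamma(I_i),\Gamma(t_i)\lambda(I_i)\big)<\varepsilon$$ for every $\delta$-fine Perron partition (respectively every $\delta$-fine partition) $\{(I_1,t_1),\dots,(I_p,t_p)\}$ of $[0,1]$. The interval variation is $\widetilde{\Phi}([0,1])=\sup\sum_i\|\Phi(I_i)\|_h$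 over all finite partitions $\{I_1,\dots,I_n\}$ of $[0,1]$ into non-overlapping closed intervals. *)

(* Defs.v *)
From HB Require Import structures.
From mathcomp Require Import all_boot all_order all_algebra.
From mathcomp Require Import all_classical all_reals all_analysis.

Set Implicit Arguments.
Unset Strict Implicit.
Unset Printing Implicit Defensive.

Import Order.TTheory GRing.Theory Num.Theory.
Import numFieldNormedType.Exports.

Local Open Scope classical_set_scope.
Local Open Scope ring_scope.

Section sets.
Context {R : realType} {X : normedModType R}.
Implicit Types A B C : set X.

Definition cb : set (set X) :=
  [set C | [/\ C !=set0, closed C, convex_set C & bounded_set C]].

Definition minkowski_sum A B : set X := [set a + b | a in A & b in B].

Definition scale_set (k : R) A : set X := [set k *: a | a in A].

(* Extended-real valued, as suprema of norms over arbitrary sets may be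
   infinite; the values are finite on cb. *)
Definition hausdorff_dist A B : \bar R :=
  maxe (ereal_sup [set edist_inf B a | a in A])
       (ereal_sup [set edist_inf A b | b in B]).

Definition set_norm C : \bar R := hausdorff_dist C [set 0].

Lemma edist_norm (x y : X) : edist (x, y) = `|x - y|%:E.
Proof.
apply/eqP; rewrite eq_le; apply/andP; split.
  apply/lee_addgt0Pr => e e0; apply: edist_fin.
    by rewrite ltr_wpDl.
  by rewrite -ball_normE /= ltrDl.
apply: le_ereal_inf_tmp => _ [r [r0 +] <-].
by rewrite -ball_normE /= lee_fin => /ltW.
Qed.

Lemma set_normE C : C !=set0 -> set_norm C = ereal_sup [set `|x|%:E | x in C].
Proof.
move=> [c Cc]; rewrite /set_norm /hausdorff_dist.
have inf0 x : edist_inf [set (0 : X)] x = `|x|%:E.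
  by rewrite /edist_inf image_set1 ereal_inf1 edist_norm subr0.
rewrite (eq_imagel (fun x _ => inf0 x)).
rewrite image_set1 ereal_sup1; apply/max_idPl.
apply: (@le_trans _ _ `|c|%:E); last by apply: ereal_sup_ubound; exists c.
by apply: ereal_inf_lbound; exists c => //; rewrite edist_norm sub0r normrN.
Qed.

End sets.

Section intervals.
Context {R : realType}.

Definition unit_itv : set R := `[0, 1]%classic.

(* Singletons are allowed: they have measure zero, and additivity forces an
   interval multimeasure to be {0} on them. *)
Definition subintervals : set (set R) :=
  [set I | exists a b : R, [/\ 0 <= a, a <= b, b <= 1 & I = `[a, b]%classic]].

Definition nonoverlapping (I J : set R) : Prop := I° `&` J° = set0.

Definition length (I : set R) : R := fine (lebesgue_measure I).

Definition interval_partition (p : nat) (I : 'I_p -> set R) : Prop :=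
  [/\ forall i, subintervals (I i),
      forall i j, i != j -> nonoverlapping (I i) (I j) &
      \bigcup_i I i = unit_itv].

Definition tagged_partition (p : nat) (I : 'I_p -> set R) (t : 'I_p -> R) :=
  interval_partition I /\ forall i, unit_itv (t i).

Definition perron_partition (p : nat) (I : 'I_p -> set R) (t : 'I_p -> R) :=
  tagged_partition I t /\ forall i, I i (t i).

Definition gauge (delta : R -> R) : Prop :=
  forall t, unit_itv t -> 0 < delta t.

Definition fine_for (delta : R -> R) (p : nat) (I : 'I_p -> set R)
    (t : 'I_p -> R) : Prop :=
  forall i, I i `<=` `[t i - delta (t i), t i + delta (t i)]%classic.

End intervals.

Section integrals.
Context {R : realType} {X : normedModType R}.
Implicit Types (Gamma : R -> set X) (Phi : set R -> set X).

(* Only the values of Phi on subintervals, and of Gamma on [0, 1], matter. *)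
Definition interval_multimeasure Phi : Prop :=
  (forall I, subintervals I -> cb (Phi I)) /\
  (forall I J, subintervals I -> subintervals J -> subintervals (I `|` J) ->
     nonoverlapping I J ->
     Phi (I `|` J) = closure (minkowski_sum (Phi I) (Phi J))).

Definition integral_error Gamma Phi (p : nat) (I : 'I_p -> set R)
    (t : 'I_p -> R) : \bar R :=
  (\sum_(i < p)
     hausdorff_dist (Phi (I i)) (scale_set (length (I i)) (Gamma (t i))))%E.

Definition vH_integral Gamma Phi : Prop :=
  interval_multimeasure Phi /\
  forall eps : R, 0 < eps -> exists delta : R -> R, gauge delta /\
    forall (p : nat) (I : 'I_p -> set R) (t : 'I_p -> R),
      perron_partition I t -> fine_for delta I t ->
      (integral_error Gamma Phi I t < eps%:E)%E.

Definition vM_integral Gamma Phi : Prop :=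
  interval_multimeasure Phi /\
  forall eps : R, 0 < eps -> exists delta : R -> R, gauge delta /\
    forall (p : nat) (I : 'I_p -> set R) (t : 'I_p -> R),
      tagged_partition I t -> fine_for delta I t ->
      (integral_error Gamma Phi I t < eps%:E)%E.

Definition vH_integrable Gamma : Prop := exists Phi, vH_integral Gamma Phi.

Definition vM_integrable Gamma : Prop := exists Phi, vM_integral Gamma Phi.

Definition interval_variation Phi : \bar R :=
  ereal_sup [set v | exists (p : nat) (I : 'I_p -> set R),
    interval_partition I /\ v = (\sum_(i < p) set_norm (Phi (I i)))%E].

End integrals.

(* Main.v *)
(* If Gamma is variationally McShane integrable, fix one fine partition J for
   eps = 1. The pieces of any partition cut along J, tagged by the tags of J,
   are McShane fine, so the variation of the integral is at most 1 plus a bound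
   for the finitely many values of |Gamma| at those tags; any Henstock integral
   is then compared with it on common fine partitions.

   Conversely let Phi be a Henstock integral of finite variation. For fixed C
   the interval function dev C (I) = d_H(Phi(I), |I| C) is subadditive of finite
   variation W_C, and on fine Perron partitions the sum of W_C exceeds the
   Henstock sum of d_H(Gamma(t), C) by little. The averages Phi(I) / |I| over
   rational intervals come close to Gamma(t) for all t outside a set of zero
   mass. Hence a step function D exists whose primitive is close to Phi in
   variation, and the Perron sums of h(t) = d_H(Gamma(t), D(t)) are small. For
   a nonnegative real function smallness of the Henstock sums implies smallness
   of the McShane sums: a Vitali selection carried out simultaneously on the
   sets {h > eps 2^k} bounds the sum of 2^k times their outer measures, and the
   McShane gauge confines tags in these sets to open supersets. As the error of
   Phi over I is at most dev D (I) + h(t) |I|, the McShane sums are small. *)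

Require Import Defs.
From mathcomp Require Import all_boot all_order all_algebra.
From mathcomp Require Import all_classical all_reals all_analysis.
From mathcomp Require Import ring lra.

Set Implicit Arguments.
Unset Strict Implicit.
Unset Printing Implicit Defensive.

Import Order.TTheory GRing.Theory Num.Theory.
Import numFieldNormedType.Exports.

Local Open Scope classical_set_scope.
Local Open Scope ring_scope.

(** * Packings and chains of tagged intervals, and Cousin's lemma *)

Section tagged_intervals.
Context {R : realType}.

(* ((a, b), t) stands for the interval [a, b] tagged by t. *)
Definition tagged : Type := (R * R * R)%type.
Implicit Types (e f p : tagged) (s P : seq tagged) (d : R -> R) (a b c x y : R).

Definition lo e := e.1.1.
Definition hi e := e.1.2.
Definition tg e := e.2.
Definition len e := hi e - lo e.

Definition within a b e := [&& a <= lo e, lo e < hi e & hi e <= b].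
Definition disj e f := (hi e <= lo f) || (hi f <= lo e).
Definition packing a b s := all (within a b) s && pairwise disj s.
Definition tfine d e := (tg e - d (tg e) <= lo e) && (hi e <= tg e + d (tg e)).
Definition perron e := lo e <= tg e <= hi e.

(** A packing is unordered and may leave gaps. [fam] is its form listed from left to right, suited
    to induction, and [chain] is the form without gaps, which tiles [a, b]. *)
Fixpoint fam a s b : bool :=
  if s is e :: s' then [&& a <= lo e, lo e < hi e & fam (hi e) s' b]
  else a <= b.

Fixpoint chain a s b : bool :=
  if s is e :: s' then [&& lo e == a, lo e < hi e & chain (hi e) s' b]
  else a == b.

Lemma disjC e f : disj e f = disj f e.
Proof. by rewrite /disj orbC. Qed.

Lemma packing_nil a b : packing a b [::].
Proof. by []. Qed.

Lemma packing_cons a b e s :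
  packing a b (e :: s) = [&& within a b e, all (disj e) s & packing a b s].
Proof.
rewrite /packing /=; case: (within a b e) => //=.
by case: (all (disj e) s) => //=; rewrite andbF.
Qed.

Lemma packing_within a b s e : packing a b s -> e \in s -> within a b e.
Proof. by move=> /andP[/allP h _] /h. Qed.

Lemma packing_filter a b s (q : pred tagged) :
  packing a b s -> packing a b [seq e <- s | q e].
Proof.
move=> /andP[h1 h2]; apply/andP; split; last exact: pairwise_filter.
by apply/allP => e; rewrite mem_filter => /andP[_] /(allP h1).
Qed.

Lemma packing_restrict a b s (q : pred tagged) x y :
  packing a b s -> (forall e, e \in s -> q e -> x <= lo e /\ hi e <= y) ->
  packing x y [seq e <- s | q e].
Proof.
move=> /andP[/allP h1 h2] h; apply/andP; split; last exact: pairwise_filter.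
apply/allP => e; rewrite mem_filter => /andP[qe es].
have [xl hy] := h _ es qe; have /and3P[_ lh _] := h1 _ es.
by apply/and3P.
Qed.

Lemma packing_weaken a b x y s : x <= a -> b <= y -> packing a b s -> packing x y s.
Proof.
move=> xa be /andP[/allP h1 h2]; apply/andP; split=> //.
apply/allP => e /h1 /and3P[ae lh eb]; apply/and3P; split=> //.
  exact: le_trans ae.
exact: le_trans eb be.
Qed.

Lemma packing_cat a b s1 s2 : packing a b s1 -> packing a b s2 ->
  allrel disj s1 s2 -> packing a b (s1 ++ s2).
Proof.
by rewrite /packing all_cat pairwise_cat => /andP[-> ->] /andP[-> ->] ->.
Qed.

Lemma packing_cat_point a b c s1 s2 : packing a b s1 -> packing b c s2 ->
  a <= b <= c -> packing a c (s1 ++ s2).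
Proof.
move=> h1 h2 /andP[ab bc]; apply: packing_cat.
- exact: packing_weaken h1.
- exact: packing_weaken h2.
- apply/allrelP => e f /(packing_within h1)/and3P[_ _ eb].
  by move=> /(packing_within h2)/and3P[bf _ _]; rewrite /disj (le_trans eb bf).
Qed.

Lemma fam_le a s b : fam a s b -> a <= b.
Proof.
elim: s a => [//|e s IH] a /= /and3P[ae lh /IH hb].
exact: le_trans ae (le_trans (ltW lh) hb).
Qed.

(** One step of insertion sort: disjointness from the head decides whether [e] goes before it or
    further right. *)
Lemma fam_insert a b s e : fam a s b -> within a b e -> all (disj e) s ->
  exists2 s', perm_eq (e :: s) s' & fam a s' b.
Proof.
elim: s a => [|f s IH] a /=.
  by move=> _ /and3P[ae lh eb] _; exists [:: e]; rewrite //= ae lh eb.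
move=> /and3P[af lhf fs] /and3P[ae lh eb] /andP[/orP[ef|fe] dis].
  by exists (e :: f :: s) => //=; rewrite ae lh ef lhf fs.
have [|s' ps' fs'] := IH (hi f) fs _ dis; first by rewrite /within fe lh eb.
exists (f :: s'); last by rewrite /= af lhf fs'.
rewrite (perm_trans (_ : perm_eq _ (f :: e :: s))) ?perm_cons //.
by rewrite -[e :: f :: s]/([:: e] ++ [:: f] ++ s) perm_catCA.
Qed.

Lemma packing_fam a b s : a <= b -> packing a b s ->
  exists2 s', perm_eq s s' & fam a s' b.
Proof.
move=> ab; elim: s => [_|e s IH]; first by exists [::].
rewrite packing_cons => /and3P[we de /IH[s' ps' fs']].
have [|s2 ps2 fs2] := fam_insert fs' we.
  by rewrite -(perm_all _ ps').
by exists s2 => //; apply: perm_trans ps2; rewrite perm_cons.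
Qed.

Lemma sum_perm s s' (F : tagged -> R) : perm_eq s s' ->
  \sum_(e <- s) F e = \sum_(e <- s') F e.
Proof. by move=> p; apply: perm_big. Qed.

(** On the sorted list, nonnegativity lets each interval absorb the gap to its left, and
    superadditivity then merges neighbours. *)
Lemma sum_superadditive (g : R -> R -> R) a b s :
  (forall x y, a <= x -> x <= y -> y <= b -> 0 <= g x y) ->
  (forall x y z, a <= x -> x <= y -> y <= z -> z <= b ->
     g x y + g y z <= g x z) ->
  a <= b -> packing a b s -> \sum_(e <- s) g (lo e) (hi e) <= g a b.
Proof.
move=> g0 gs ab /(packing_fam ab)[s' /sum_perm -> {s}].
elim: s' a g0 gs ab => [|e s IH] a g0 gs ab /=.
  by move=> _; rewrite big_nil; apply: g0.
move=> /and3P[ae lh fs]; rewrite big_cons.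
have hb := fam_le fs.
have ah : a <= hi e by rewrite (le_trans ae (ltW lh)).
have le1 : g (lo e) (hi e) <= g a (hi e).
  have := gs a (lo e) (hi e) (lexx _) ae (ltW lh) hb.
  have := g0 a (lo e) (lexx _) ae (le_trans (ltW lh) hb); lra.
have := gs a (hi e) b (lexx _) ah hb (lexx _).
suff : \sum_(j <- s) g (lo j) (hi j) <= g (hi e) b by lra.
apply: IH fs => //.
- by move=> x y hx; apply: g0; apply: le_trans hx.
- by move=> x y z hx; apply: gs; apply: le_trans hx.
Qed.

Lemma sum_len_le a b s : a <= b -> packing a b s -> \sum_(e <- s) len e <= b - a.
Proof.
move=> ab ps; apply: (@sum_superadditive (fun x y => y - x)) => //.
- by move=> x y _ xy _; rewrite subr_ge0.
- by move=> x y z *; lra.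
Qed.

Lemma chain_le a s b : chain a s b -> a <= b.
Proof.
elim: s a => [a /eqP->//|e s IH] a /= /and3P[/eqP<- lh /IH].
exact/le_trans/ltW.
Qed.

Lemma chain_fam a s b : chain a s b -> fam a s b.
Proof.
elim: s a => [a /eqP->//=|e s IH] a /= /and3P[/eqP<- lh /IH ->].
by rewrite lexx lh.
Qed.

Lemma fam_packing a s b : fam a s b -> packing a b s.
Proof.
elim: s a => [//|e s IH] a /= /and3P[ae lh fs].
have ps := IH _ fs; rewrite packing_cons; apply/and3P; split.
- by rewrite /within ae lh (fam_le fs).
- apply/allP => f /(packing_within ps)/and3P[h _ _].
  by rewrite /disj h.
- by apply: packing_weaken ps => //; rewrite (le_trans ae (ltW lh)).
Qed.

Lemma chain_packing a s b : chain a s b -> packing a b s.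
Proof. by move=> /chain_fam/fam_packing. Qed.

Lemma chain_cat a s b s' c : chain a s b -> chain b s' c -> chain a (s ++ s') c.
Proof.
elim: s a => [a /eqP->//|e s IH] a /= /and3P[-> -> /IH h] /h; exact.
Qed.

Lemma sum_subadditive (g : R -> R -> R) a s b :
  (forall x y z, a <= x -> x <= y -> y <= z -> z <= b ->
     g x z <= g x y + g y z) ->
  (forall x, a <= x -> x <= b -> g x x <= 0) ->
  chain a s b -> g a b <= \sum_(e <- s) g (lo e) (hi e).
Proof.
elim: s a => [|e s IH] a gs g0 /=.
  by move=> /eqP ab; rewrite big_nil -ab g0 // ab.
move=> /and3P[/eqP ea lh cs]; rewrite big_cons ea.
have hb := chain_le cs; rewrite ea in lh.
have := gs a (hi e) b (lexx _) (ltW lh) hb (lexx _).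
suff : g (hi e) b <= \sum_(j <- s) g (lo j) (hi j) by lra.
apply: IH cs => //.
- by move=> x y z hx; apply: gs; rewrite (le_trans (ltW lh)).
- by move=> x hx; apply: g0; rewrite (le_trans (ltW lh)).
Qed.

(** The link that contains x and a right neighbourhood of it cannot end before y, since no
    breakpoint lies strictly between x and y. *)
Lemma chain_locate a P b x y : chain a P b -> a <= x -> x < y -> y <= b ->
  (forall p, p \in P -> ~~ (x < lo p < y) /\ ~~ (x < hi p < y)) ->
  exists2 p, p \in P & lo p <= x /\ y <= hi p.
Proof.
elim: P a => [|p P IH] a /=.
  by move=> /eqP -> bx xy yb; have := le_lt_trans bx (lt_le_trans xy yb); rewrite ltxx.
move=> /and3P[/eqP pa lh cP] ax xy yb nb.
have [hx|xh] := leP (hi p) x.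
  have [|q qP h] := IH _ cP hx xy yb.
    by move=> q qP; apply: nb; rewrite inE qP orbT.
  by exists q => //; rewrite inE qP orbT.
have [_] := nb p (mem_head _ _); rewrite xh /= -leNgt => yh.
by exists p; rewrite ?mem_head // pa.
Qed.

(** Cousin's lemma. Let c be the supremum of the points reached by fine Perron chains; one more
    interval tagged at c passes beyond c, which is impossible unless b is already in reach. *)
Lemma cousin d a b : (forall t, a <= t -> t <= b -> 0 < d t) -> a <= b ->
  exists2 s, chain a s b &
    all (fun e => tfine d e && perron e) s.
Proof.
move=> d0 ab.
pose ok x := exists2 s, chain a s x & all (fun e => tfine d e && perron e) s.
pose S := [set x | [/\ a <= x, x <= b & ok x]].
have Sa : S a by split=> //; exists [::] => //=; rewrite eqxx.
have supS : has_sup S by split; [exists a | exists b => x []].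
pose c := sup S.
have ac : a <= c by apply: ub_le_sup Sa; case: supS.
have cb : c <= b by apply: ge_sup => [|x []//]; exists a.
have dc := d0 c ac cb.
have [x Sx xc] := sup_adherent dc supS.
have xlec : x <= c by apply: ub_le_sup Sx; case: supS.
case: Sx => ax xb [s cs fs].
(* The new link runs from x to y with tag c. If y = x it would be degenerate, and the old chain
   serves as it is. *)
have ext y : c <= y -> y <= b -> y <= c + d c -> ok y.
  move=> cy yb yd; have [xy|yx] := ltP x y; last first.
    have -> : y = x by apply/le_anti; rewrite yx (le_trans xlec).
    by exists s.
  exists (s ++ [:: ((x, y), c)]).
    by apply: chain_cat cs _; rewrite /= /lo /hi /= !eqxx xy.
  rewrite all_cat fs /= /tfine /perron /lo /hi /tg /= xlec cy yd !andbT.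
  by apply: ltW.
have [cbd|bcd] := ltP (c + d c) b; last by have [|s' ? ?] := ext b cb (lexx _); [|exists s'].
have : S (c + d c).
  by split; [lra|exact: ltW|apply: ext => //; lra].
move=> /(ub_le_sup (proj2 supS)); rewrite -/c; lra.
Qed.

(** Cousin's lemma fills the gaps with fine Perron intervals. The property [Q] is left abstract so
    that the same lemma completes Perron and McShane families to full partitions. *)
Lemma fam_extend d (Q : pred tagged) a b s :
  (forall t, a <= t -> t <= b -> 0 < d t) ->
  (forall e, within a b e -> tfine d e -> perron e -> Q e) ->
  fam a s b -> all Q s ->
  exists s' r, [/\ chain a s' b, all Q s' & perm_eq (s ++ r) s'].
Proof.
elim: s a => [|e s IH] a d0 Q0 /=.
  move=> ab _; have [s' cs' fs'] := cousin d0 ab; exists s', s'; split=> //.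
  apply/allP => e es; have /andP[fe pe] := allP fs' e es.
  exact: Q0 (packing_within (chain_packing cs') es) fe pe.
move=> /and3P[ae lh fs] /andP[Qe Qs].
have hb := fam_le fs.
have ah : a <= hi e by rewrite (le_trans ae (ltW lh)).
have lb : lo e <= b by rewrite (le_trans (ltW lh)).
have d1 t : hi e <= t -> t <= b -> 0 < d t.
  by move=> ht; apply: d0; rewrite (le_trans _ ht).
have d2 t : a <= t -> t <= lo e -> 0 < d t.
  by move=> ? ht; apply: d0 => //; rewrite (le_trans ht).
have Q1 f : within (hi e) b f -> tfine d f -> perron f -> Q f.
  by move=> /and3P[h ? ?]; apply: Q0; apply/and3P; split=> //; apply: le_trans h.
have [s' [r [cs' fs' pr]]] := IH (hi e) d1 Q1 fs Qs.
have [c cc fc] := cousin d2 ae.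
exists (c ++ e :: s'), (c ++ r); split.
- by apply: chain_cat cc _; rewrite /= eqxx lh.
- rewrite all_cat /=; apply/and3P; split=> //; apply/allP => f fin.
  have /andP[ff pf] := allP fc f fin.
  have /and3P[? ? h] := packing_within (chain_packing cc) fin.
  by apply: Q0 => //; apply/and3P; split=> //; apply: le_trans lb.
- by rewrite -cat_cons perm_catCA perm_cat2l /= perm_cons.
Qed.

Lemma packing_extend d (Q : pred tagged) a b s :
  (forall t, a <= t -> t <= b -> 0 < d t) ->
  (forall e, within a b e -> tfine d e -> perron e -> Q e) ->
  a <= b -> packing a b s -> all Q s ->
  exists s' r, [/\ chain a s' b, all Q s' & perm_eq (s ++ r) s'].
Proof.
move=> d0 Q0 ab /(packing_fam ab)[s1 ps fs]; rewrite (perm_all _ ps) => al.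
have [s' [r [? ? pr]]] := fam_extend d0 Q0 fs al; exists s', r; split=> //.
by apply: perm_trans pr; rewrite perm_cat2r.
Qed.

Lemma sum_le_cover (I : eqType) (P : seq I) s (rel : I -> tagged -> bool)
    (F : tagged -> R) :
  (forall e, e \in s -> 0 <= F e) ->
  (forall e, e \in s -> exists2 p, p \in P & rel p e) ->
  \sum_(e <- s) F e <= \sum_(p <- P) \sum_(e <- s | rel p e) F e.
Proof.
move=> F0 cov.
under [leRHS]eq_bigr do rewrite big_mkcond.
rewrite exchange_big /= big_seq [leRHS]big_seq; apply: ler_sum => e es.
have [p pP re] := cov e es.
rewrite (big_rem p) //= re lerDl; apply: sumr_ge0 => q _.
by case: ifP => // _; apply: F0.
Qed.

Lemma avoid_points (B : seq R) t :
  exists2 r : R, 0 < r & forall b, b \in B -> b != t -> r < `|b - t|.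
Proof.
elim: B => [|b B [r r0 h]]; first by exists 1.
have [->|bt] := eqVneq b t.
  by exists r => // c; rewrite inE => /orP[/eqP->|/h//]; rewrite eqxx.
have bt0 : 0 < `|b - t| by rewrite normr_gt0 subr_eq0.
exists (Num.min r (`|b - t| / 2)); first by rewrite lt_min r0 divr_gt0.
move=> c; rewrite inE gt_min => /orP[/eqP->|cB ct]; last by rewrite h.
by move=> _; apply/orP; right; lra.
Qed.

(** The gauge at t stays below the distance from t to the other points of [B]. This makes fine
    intervals respect the breakpoints of a fixed chain. *)
Lemma tfine_avoid (B : seq R) : exists2 d : R -> R, (forall t, 0 < d t) &
  forall e b, b \in B -> tfine d e -> lo e <= b <= hi e -> b = tg e.
Proof.
have [d hd] := choice (fun t => let: ex_intro2 r r0 h := avoid_points B t in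
   ex_intro (fun r => 0 < r /\ forall b, b \in B -> b != t -> r < `|b - t|) r (conj r0 h)).
exists d => [t|e b bB]; first by have [] := hd t.
rewrite /tfine => /andP[h1 h2] /andP[h3 h4]; apply/eqP/negPn/negP => ne.
have [_ /(_ _ bB ne)] := hd (tg e).
rewrite ltNge => /negP; apply; rewrite ler_norml; lra.
Qed.

Lemma tfine_le (d d' : R -> R) e : d (tg e) <= d' (tg e) -> tfine d e -> tfine d' e.
Proof. by rewrite /tfine => dd /andP[? ?]; apply/andP; split; lra. Qed.

End tagged_intervals.

(** * Hausdorff distance of bounded sets *)

Section hausdorff.
Context {R : realType} {X : normedModType R}.
Implicit Types (A B C D : set X) (r x y : R).

Definition bounded_convex A :=
  [/\ A !=set0, (exists M : R, forall a, A a -> `|a| <= M) &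
   forall (k : R) a b, 0 <= k -> k <= 1 -> A a -> A b -> A (k *: a + (1 - k) *: b)].

(** One half of the Hausdorff distance being at most r. The slack e is there because the distance
    from a point to a set need not be attained. *)
Definition near_set A B r :=
  forall e, 0 < e -> forall a, A a -> exists2 b, B b & `|a - b| <= r + e.

(** The real value is meaningful for nonempty bounded sets, where the extended distance is
    finite. *)
Definition hdist A B : R := fine (hausdorff_dist A B).

Lemma cb_bounded_convex A : cb A -> bounded_convex A.
Proof.
move=> [A0 _ cA bA]; split=> //.
  have [M [Mreal h]] := bA; exists (M + 1) => a Aa.
  by apply: (h (M + 1)) => //; rewrite ltrDl.
move=> k a b k0 k1 Aa Ab.
have [-> |kn0] := eqVneq k 0; first by rewrite scale0r add0r subr0 scale1r.
have [-> |kn1] := eqVneq k 1; first by rewrite subrr scale0r addr0 scale1r.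
have kp : 0 < k by rewrite lt_neqAle eq_sym kn0.
have kl : k < 1 by rewrite lt_neqAle kn1.
by have /convex_setW/(_ a b (mem_set Aa) (mem_set Ab) (Itv01 k0 k1) kp kl) := cA; rewrite inE.
Qed.

Lemma hausdorff_dist_leP A B r : A !=set0 -> B !=set0 ->
  near_set A B r -> near_set B A r -> (hausdorff_dist A B <= r%:E)%E.
Proof.
have half A' B' : near_set A' B' r ->
    (ereal_sup [set edist_inf B' a | a in A'] <= r%:E)%E.
  move=> nAB; apply: ge_ereal_sup => _ [a Aa <-].
  apply/lee_addgt0Pr => e e0; have [b Bb ab] := nAB e e0 a Aa.
  apply: ge_ereal_inf; exists (edist (a, b)); first by exists b.
  by rewrite edist_norm.
by move=> _ _ n1 n2; rewrite /hausdorff_dist ge_max !half.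
Qed.

Lemma le_hausdorff_dist A B r : (hausdorff_dist A B <= r%:E)%E ->
  near_set A B r /\ near_set B A r.
Proof.
have half A' B' : (ereal_sup [set edist_inf B' a | a in A'] <= r%:E)%E ->
    near_set A' B' r.
  move=> h e e0 a Aa.
  have : (edist_inf B' a < (r + e)%:E)%E.
    apply: (@le_lt_trans _ _ r%:E); last by rewrite lte_fin ltrDl.
    by apply: le_trans h; apply: ereal_sup_ubound; exists a.
  move=> /ereal_inf_lt[_ [b Bb <-]]; rewrite edist_norm lte_fin => /ltW ab.
  by exists b.
by rewrite /hausdorff_dist ge_max => /andP[/half h1 /half h2].
Qed.

Lemma hausdorff_dist_ge0 A B : A !=set0 -> (0 <= hausdorff_dist A B)%E.
Proof.
move=> [a Aa]; rewrite /hausdorff_dist le_max; apply/orP; left.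
apply: le_trans (edist_inf_ge0 B a) _.
by apply: ereal_sup_ubound; exists a.
Qed.

Definition bounded_nonempty A := A !=set0 /\ exists M : R, forall a, A a -> `|a| <= M.

Lemma bounded_convexW A : bounded_convex A -> bounded_nonempty A.
Proof. by case. Qed.

Lemma hausdorff_dist_fin A B : bounded_nonempty A -> bounded_nonempty B ->
  hausdorff_dist A B = (hdist A B)%:E.
Proof.
move=> [[a Aa] [M hM]] [[b Bb] [N hN]]; rewrite fineK //.
rewrite ge0_fin_numE; last by apply: hausdorff_dist_ge0; exists a.
apply: (@le_lt_trans _ _ (M + N)%:E); last by rewrite ltry.
apply: hausdorff_dist_leP; [by exists a|by exists b| |].
- move=> e e0 c Ac; exists b => //; rewrite (le_trans (ler_normB _ _))//.
  by have := hM _ Ac; have := hN _ Bb; lra.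
- move=> e e0 c Bc; exists a => //; rewrite (le_trans (ler_normB _ _))//.
  by have := hM _ Aa; have := hN _ Bc; lra.
Qed.

Lemma hdist_near A B : bounded_nonempty A -> bounded_nonempty B ->
  near_set A B (hdist A B) /\ near_set B A (hdist A B).
Proof. by move=> a b; apply: le_hausdorff_dist; rewrite hausdorff_dist_fin. Qed.

Lemma hdist_le A B r : A !=set0 -> B !=set0 ->
  near_set A B r -> near_set B A r -> hdist A B <= r.
Proof.
move=> A0 B0 n1 n2; have le := hausdorff_dist_leP A0 B0 n1 n2.
rewrite /hdist -lee_fin fineK // ge0_fin_numE ?hausdorff_dist_ge0 //.
by apply: le_lt_trans le _; rewrite ltry.
Qed.

Lemma hdist_ge0 A B : A !=set0 -> 0 <= hdist A B.
Proof. by move=> A0; rewrite fine_ge0 ?hausdorff_dist_ge0. Qed.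

Lemma hdistC A B : hdist A B = hdist B A.
Proof. by rewrite /hdist /hausdorff_dist maxC. Qed.

Lemma near_set_trans A B C r x : near_set A B r -> near_set B C x ->
  near_set A C (r + x).
Proof.
move=> h1 h2 e e0 a Aa; have e2 : 0 < e / 2 by lra.
have [b Bb ab] := h1 _ e2 a Aa; have [c Cc bc] := h2 _ e2 b Bb.
by exists c => //; have := ler_distD b a c; lra.
Qed.

Lemma hdist_triangle B A C : bounded_nonempty A -> bounded_nonempty B ->
  bounded_nonempty C -> hdist A C <= hdist A B + hdist B C.
Proof.
move=> bA bB bC; have [ab ba] := hdist_near bA bB; have [bc cb] := hdist_near bB bC.
apply: hdist_le; [by case: bA|by case: bC|exact: near_set_trans bc|].
by rewrite addrC; apply: near_set_trans ba.
Qed.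

Lemma near_set_scale k A B r : near_set A B r ->
  near_set (scale_set k A) (scale_set k B) (`|k| * r).
Proof.
move=> h e e0 _ [a Aa <-].
have [b Bb ab] := h (e / (`|k| + 1)) (divr_gt0 e0 (ltr_wpDl (normr_ge0 _) ltr01)) a Aa.
exists (k *: b); first by exists b.
rewrite -scalerBr normrZ (le_trans (ler_wpM2l (normr_ge0 _) ab))// mulrDr lerD2l.
rewrite mulrCA ger_pMr // ler_pdivrMr ?ltr_wpDl // mul1r; lra.
Qed.

Lemma bounded_nonempty_scale k A : bounded_nonempty A ->
  bounded_nonempty (scale_set k A).
Proof.
move=> [[a Aa] [M hM]]; split; first by exists (k *: a), a.
by exists (`|k| * M) => _ [b Bb <-]; rewrite normrZ ler_wpM2l ?hM.
Qed.

Lemma hdist_scale k A B : bounded_nonempty A -> bounded_nonempty B ->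
  hdist (scale_set k A) (scale_set k B) <= `|k| * hdist A B.
Proof.
move=> bA bB; have [ab ba] := hdist_near bA bB.
apply: hdist_le; [by case: (bounded_nonempty_scale k bA)|
  by case: (bounded_nonempty_scale k bB)| |]; exact: near_set_scale.
Qed.

Lemma scale_set_comp k x A : scale_set k (scale_set x A) = scale_set (k * x) A.
Proof.
rewrite /scale_set image_comp; apply: eq_imagel => a _ /=.
by rewrite scalerA.
Qed.

Lemma scale_set1 A : scale_set 1 A = A.
Proof.
by rewrite /scale_set (eq_imagel (fun a _ => scale1r a)) image_id.
Qed.

Lemma scale_set_zero k : scale_set k [set 0] = [set (0 : X)].
Proof. by rewrite /scale_set image_set1 scaler0. Qed.

Lemma scale_set0r A : A !=set0 -> scale_set 0 A = [set (0 : X)].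
Proof.
move=> [a Aa]; apply/seteqP; split=> [_ [b _ <-]|_ ->]; first by rewrite /= scale0r.
by exists a; rewrite ?scale0r.
Qed.

Lemma bounded_convex_scale k A : bounded_convex A -> bounded_convex (scale_set k A).
Proof.
move=> cA; have [A0 bA h] := cA.
have [? ?] := bounded_nonempty_scale k (bounded_convexW cA); split=> //.
move=> l _ _ l0 l1 [a Aa <-] [b Bb <-]; exists (l *: a + (1 - l) *: b).
  exact: h.
by rewrite scalerDr !scalerA ![k * _]mulrC.
Qed.

Lemma bounded_convex0 : bounded_convex [set (0 : X)].
Proof.
split; [by exists 0|by exists 0 => a ->; rewrite normr0|].
by move=> k a b _ _ -> ->; rewrite /= !scaler0 addr0.
Qed.

Lemma closure_near A r a : closure A a -> 0 < r -> exists2 b, A b & `|a - b| <= r.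
Proof.
move=> cA r0; have [b [Ab /=]] := cA (ball a r) (nbhsx_ballx a r r0).
by rewrite -ball_normE /= => /ltW; exists b.
Qed.

(** The source of all subadditivity below. Convexity of [C] rewrites x c + y d as (x + y) v with v
    in [C], and the closure costs only an arbitrarily small error. *)
Lemma hdist_closure_add A B C x y : bounded_nonempty A -> bounded_nonempty B ->
  bounded_convex C -> 0 <= x -> 0 <= y ->
  hdist (closure (minkowski_sum A B)) (scale_set (x + y) C) <=
  hdist A (scale_set x C) + hdist B (scale_set y C).
Proof.
move=> bA bB cC x0 y0; have bC := bounded_convexW cC.
have [C0 _ convC] := cC.
have [n1 n2] := hdist_near bA (bounded_nonempty_scale x bC).
have [m1 m2] := hdist_near bB (bounded_nonempty_scale y bC).
set r := hdist A _ in n1 n2 *; set q := hdist B _ in m1 m2 *.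
have [[a0 A0] _] := bA; have [[b0 B0] _] := bB; have [c0 Cc0] := C0.
have sub : minkowski_sum A B `<=` closure (minkowski_sum A B) by exact: subset_closure.
have dist4 (a b c d : X) : `|a + b - (c + d)| <= `|a - c| + `|b - d|.
  by rewrite opprD addrACA ler_normD.
apply: hdist_le.
- by exists (a0 + b0); apply: sub; exists a0 => //; exists b0.
- by exists ((x + y) *: c0), c0.
- move=> e e0 z cz; have e3 : 0 < e / 3 by lra.
  have [_ [a Aa [b Bb <-]] zab] := closure_near cz e3.
  have [_ [c Cc <-] ac] := n1 _ e3 a Aa.
  have [_ [d Cd <-] bd] := m1 _ e3 b Bb.
  have fin v : (x + y) *: v = x *: c + y *: d -> C v ->
      exists2 w, scale_set (x + y) C w & `|z - w| <= r + q + e.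
    move=> vE Cv; exists ((x + y) *: v); first by exists v.
    have := ler_distD (a + b) z ((x + y) *: v); rewrite vE.
    have := dist4 a b (x *: c) (y *: d); lra.
  have [xy0|xyn0] := eqVneq (x + y) 0.
    apply: (fin c) => //.
    have xE : x = 0 by lra.
    have yE : y = 0 by lra.
    by rewrite xE yE addr0 !scale0r addr0.
  have xyp : 0 < x + y by lra.
  (* The convex combination with weights x / (x + y) and y / (x + y). *)
  apply: (fin ((x / (x + y)) *: c + (1 - x / (x + y)) *: d)).
    rewrite scalerDr !scalerA mulrBr mulr1 mulrCA mulfV // mulr1.
    by congr (_ + _ *: _); lra.
  apply: convC => //; first by rewrite divr_ge0 // ltW.
  by rewrite ler_pdivrMr // mul1r; lra.
- move=> e e0 _ [c Cc <-]; have e2 : 0 < e / 2 by lra.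
  have [|a Aa ac] := n2 _ e2 (x *: c); first by exists c.
  have [|b Bb bc] := m2 _ e2 (y *: c); first by exists c.
  exists (a + b); first by apply: sub; exists a => //; exists b.
  by rewrite scalerDl; have := dist4 (x *: c) (y *: c) a b; lra.
Qed.

(* The norm of A is twice itself, since A + A contains 2 A. *)
Lemma hdist_idempotent A : bounded_nonempty A ->
  A = closure (minkowski_sum A A) -> hdist A [set 0] = 0.
Proof.
move=> bA eA; have [[a Aa] _] := bA.
have b0 := bounded_convexW bounded_convex0.
have [n1 n2] := hdist_near bA b0.
set r := hdist _ _ in n1 n2 *.
have r0 : 0 <= r by apply: hdist_ge0; exists a.
have small c : A c -> `|c| <= r / 2.
  move=> Ac; have A2 : A (c + c).
    by rewrite eA; apply: subset_closure; exists c => //; exists c.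
  apply/ler_addgt0Pr => e e0; have e2 : 0 < 2 * e by lra.
  have [_ -> ] := n1 _ e2 _ A2.
  rewrite subr0 -mulr2n normrMn -mulr_natl; lra.
suff : r <= r / 2 by lra.
apply: hdist_le; [by exists a|by exists 0| |].
- move=> e e0 c Ac; exists 0 => //; rewrite subr0; have := small c Ac; lra.
- move=> e e0 c ->; exists a => //; rewrite sub0r normrN; have := small a Aa; lra.
Qed.

(** Rescaling by the inverse of k. With k the length of an interval and [B] the value of the
    multimeasure on it, this turns the error into the distance to an average. *)
Lemma hdist_scale_diff k A B : 0 < k -> bounded_nonempty A -> bounded_nonempty B ->
  k * hdist A (scale_set k^-1 B) <= hdist (scale_set k A) B.
Proof.
move=> k0 bA bB; rewrite -ler_pdivlMl //.
have kn : k != 0 by rewrite gt_eqF.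
have := hdist_scale k^-1 (bounded_nonempty_scale k bA) bB.
by rewrite scale_set_comp mulVf // scale_set1 ger0_norm // invr_ge0 ltW.
Qed.

End hausdorff.

(** * Vitali selection and outer measure *)

Section vitali_selection.
Context {R : realType}.
Implicit Types (e f : @tagged R) (s L : seq (@tagged R)) (A B : set R) (d : R -> R).

(** Lebesgue outer measure: the level sets to which it is applied need not be measurable. *)
Definition omeas A : \bar R := ((@wlength R idfun)^* A)%mu.

(** Rational endpoints leave countably many intervals to choose from, both in the Vitali selection
    and among the averages of the multimeasure. *)
Definition rational_ends e := exists p q : rat, lo e = ratr p /\ hi e = ratr q.

Lemma omeas_le A B : A `<=` B -> (omeas A <= omeas B)%E.
Proof. by move=> AB; apply: le_outer_measure. Qed.

Lemma omeasU A B : (omeas (A `|` B) <= omeas A + omeas B)%E.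
Proof. exact: outer_measureU2. Qed.

Lemma omeas_lebesgue A : omeas A = lebesgue_measure A.
Proof. by []. Qed.

Lemma omeas_cc (x y : R) : x <= y -> omeas `[x, y]%classic = (y - x)%:E.
Proof.
move=> xy; rewrite omeas_lebesgue lebesgue_measure_itv /= lte_fin.
have [_|yx] := ltP x y; first by rewrite EFinB.
have -> : y = x by apply/le_anti; rewrite xy yx.
by rewrite subrr.
Qed.

Lemma omeas_oo (x y : R) : x < y -> omeas `]x, y[%classic = (y - x)%:E.
Proof.
by move=> xy; rewrite omeas_lebesgue lebesgue_measure_itv /= lte_fin xy EFinB.
Qed.

Lemma omeas0 : omeas set0 = 0%E.
Proof. exact: outer_measure0. Qed.

Lemma omeas_ge0 A : (0 <= omeas A)%E.
Proof. exact: outer_measure_ge0. Qed.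

Lemma omeas_unit A : A `<=` `]0, 1[%classic -> (omeas A <= 1)%E.
Proof.
by move=> /omeas_le/le_trans; apply; rewrite omeas_oo ?ltr01 // subr0.
Qed.

Definition ounion L : set R := \big[setU/set0]_(e <- L) `]lo e, hi e[%classic.

Lemma ounionP L x : ounion L x <-> exists2 e, e \in L & lo e < x < hi e.
Proof.
rewrite /ounion; elim: L => [|e L IH].
  by rewrite big_nil; split=> // -[].
rewrite big_cons; split=> [[/=|/IH[f fL h]]|[f]].
- by rewrite in_itv /= => h; exists e; rewrite ?mem_head.
- by exists f; rewrite // inE fL orbT.
- rewrite inE => /orP[/eqP->|fL] h; first by left; rewrite /= in_itv.
  by right; apply/IH; exists f.
Qed.

Lemma exists_longest L : L != [::] ->
  exists2 e, e \in L & forall f, f \in L -> len f <= len e.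
Proof.
elim: L => // e L IH _; have [->|/IH[f fL h]] := eqVneq L [::].
  by exists e; rewrite ?mem_head // => f; rewrite inE => /eqP->.
have [ef|/ltW fe] := leP (len e) (len f).
  by exists f; [rewrite inE fL orbT|move=> g; rewrite inE => /orP[/eqP->//|/h]].
exists e; first by rewrite mem_head.
by move=> g; rewrite inE => /orP[/eqP->//|/h/le_trans]; apply.
Qed.

(** Greedy Vitali covering: keep a longest interval, discard all that overlap it, and recurse. The
    discarded ones lie in its threefold enlargement, whence the factor 3. *)
Lemma finite_vitali L : (forall e, e \in L -> lo e < hi e) ->
  exists s, [/\ pairwise disj s, {subset s <= L} &
    (omeas (ounion L) <= (3 * \sum_(e <- s) len e)%:E)%E].
Proof.
have [n] := ubnP (size L); elim: n L => // n IH L szL pos.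
have [->|/exists_longest[e eL long]] := eqVneq L [::].
  by exists [::]; split=> //; rewrite /ounion !big_nil omeas0 mulr0.
pose L' := [seq f <- L | disj e f].
have lhe := pos e eL.
have eL' : e \notin L'.
  by rewrite mem_filter /disj orbb leNgt lhe.
have szL' : (size L' < n)%N.
  have szsub : (size L' < size L)%N.
    rewrite size_filter -(count_predC (disj e)) -[ltnLHS]addn0 ltn_add2l -has_count.
    by apply/hasP; exists e; rewrite //= /disj orbb -ltNge.
  exact: leq_trans szsub _.
have [|s [ps sL' le]] := IH L' szL'.
  by move=> f; rewrite mem_filter => /andP[_ /pos].
exists (e :: s); split.
- rewrite /= ps andbT; apply/allP => f /sL'; rewrite mem_filter => /andP[]//.
- move=> f; rewrite inE => /orP[/eqP->//|/sL']; rewrite mem_filter => /andP[]//.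
rewrite big_cons mulrDr EFinD.
apply: le_trans (leeD2l _ le).
have -> : (3 * len e)%:E = omeas `](lo e - len e), (hi e + len e)[%classic.
  rewrite omeas_oo /len; last by lra.
  by congr (_%:E); lra.
apply: le_trans (omeasU _ _); apply: omeas_le => x /ounionP[f fL /andP[fx xf]].
have [def|ndef] := boolP (disj e f).
  by right; apply/ounionP; exists f; rewrite ?fx // mem_filter def.
left; rewrite /= in_itv /=; have := long f fL.
move: ndef; rewrite /disj negb_or -!ltNge /len => /andP[? ?] ?.
by apply/andP; split; lra.
Qed.

Lemma rat_between (x y : R) : x < y -> exists q : rat, x < ratr q < y.
Proof. by move=> /rat_in_itvoo[q]; rewrite in_itv; exists q. Qed.

(** The fine rational intervals tagged in [A] can be enumerated, and their interiors cover [A].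
    Continuity from below gives finitely many of them whose union exceeds c in measure, to which
    [finite_vitali] applies. *)
Lemma vitali_selection A d (c : R) : A `<=` `]0, 1[%classic ->
  (forall t, A t -> 0 < d t) -> (c%:E < omeas A)%E ->
  exists s, [/\ packing 0 1 s,
    forall e, e \in s -> [/\ A (tg e), tfine d e, perron e & rational_ends e] &
    c / 3 <= \sum_(e <- s) len e].
Proof.
move=> A01 d0 cA.
pose good e := [/\ A (tg e), tfine d e, perron e, rational_ends e & within 0 1 e].
pose goodpq (pq : rat * rat) t := good ((ratr pq.1, ratr pq.2), t).
(* The pair of endpoints coded by n receives one chosen admissible tag, if there is any. *)
pose pick (n : nat) : option (@tagged R) :=
  if unpickle n is Some pq then
    match pselect (exists t, goodpq pq t) with
    | left h => Some ((ratr pq.1, ratr pq.2), sval (cid h))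
    | right _ => None end
  else None.
pose L n := pmap pick (iota 0 n).
have goodL n e : e \in L n -> good e.
  rewrite mem_pmap => /mapP[k _]; rewrite /pick.
  by case: unpickle => // pq; case: pselect => // h [->]; case: cid.
have Lcov : A `<=` \bigcup_n ounion (L n).
  move=> t At; have /= := A01 t At; rewrite in_itv /= => /andP[t0 t1].
  have dt := d0 t At.
  have [|p /andP[p1 p2]] := @rat_between (Num.max 0 (t - d t)) t.
    by rewrite gt_max t0; lra.
  have [|q /andP[q1 q2]] := @rat_between t (Num.min 1 (t + d t)).
    by rewrite lt_min t1; lra.
  move: p1 q2; rewrite gt_max lt_min => /andP[p0 pd] /andP[q0 qd].
  have ex : exists t', goodpq (p, q) t'.
    exists t; split=> //; rewrite ?/tfine ?/perron ?/within /lo /hi /tg /=.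
    - by rewrite !ltW.
    - by rewrite !ltW.
    - by exists p, q.
    - by rewrite !ltW //= (lt_trans p2 q1).
  (* The successor, because [L n] uses the codes strictly below n. *)
  exists (pickle (p, q)).+1 => //; apply/ounionP.
  case: (pselect (exists t', goodpq (p, q) t')) => // h.
  exists ((ratr p, ratr q), sval (cid h)); last by rewrite /lo /hi /= p2 q1.
  rewrite /L mem_pmap; apply/mapP; exists (pickle (p, q)).
    by rewrite mem_iota leq0n add0n ltnSn.
  rewrite /pick pickleK; case: pselect => [h'|//].
  by congr (Some (_, sval (cid _))); exact: Prop_irrelevance.
have mL n : measurable (ounion (L n)).
  by rewrite /ounion; apply: bigsetU_measurable => e _; exact: measurable_itv.
have Lmono : {homo (fun n => ounion (L n)) : n m / (n <= m)%N >-> (n <= m)%O}.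
  move=> n m nm; apply/subsetPset => x /ounionP[e eL h]; apply/ounionP; exists e => //.
  by rewrite /L -(subnKC nm) iotaD pmap_cat mem_cat -/(L n) eL.
have [n cn] : exists n, (c%:E < omeas (ounion (L n)))%E.
  apply: contrapT => /forallNP h.
  have : (omeas (\bigcup_n ounion (L n)) <= c%:E)%E.
    have cv := @nondecreasing_cvg_mu _ _ _ lebesgue_measure _ mL
      (bigcupT_measurable _ mL) Lmono.
    rewrite omeas_lebesgue -(cvg_lim _ cv)//.
    apply: lime_le; first by apply/cvg_ex; eexists; exact: cv.
    by apply: nearW => k /=; rewrite leNgt; apply/negP/h.
  by rewrite leNgt => /negP; apply; apply: lt_le_trans cA (omeas_le Lcov).
have [|s [ps sL le]] := @finite_vitali (L n).
  by move=> e /goodL[_ _ _ _ /and3P[]].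
exists s; split.
- by rewrite /packing ps andbT; apply/allP => e /sL/goodL[].
- by move=> e /sL/goodL[].
- have := lt_le_trans cn le; rewrite lte_fin; lra.
Qed.

Definition cunion L : set R := \big[setU/set0]_(e <- L) `[lo e, hi e]%classic.

Lemma cunion_mem L e x : e \in L -> lo e <= x <= hi e -> cunion L x.
Proof.
rewrite /cunion; elim: L => // f L IH; rewrite inE big_cons => /orP[/eqP<-|eL] h.
  by left; rewrite /= in_itv.
by right; apply: IH.
Qed.

Lemma omeas_cunion L : (forall e, e \in L -> lo e < hi e) ->
  (omeas (cunion L) <= (\sum_(e <- L) len e)%:E)%E.
Proof.
rewrite /cunion; elim: L => [_|e L IH pos]; first by rewrite !big_nil omeas0.
rewrite !big_cons EFinD; apply: le_trans (omeasU _ _) _; apply: leeD.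
  by rewrite omeas_cc // ltW // pos // mem_head.
by apply: IH => f fL; apply: pos; rewrite inE fL orbT.
Qed.

(** Vitali selection in [A] minus the closed intervals of [s0], which still has outer measure above
    c. A gauge avoiding the endpoints of [s0] prevents an interval tagged outside these intervals
    from entering them. *)
Lemma vitali_selection_away A d s0 (c : R) : A `<=` `]0, 1[%classic ->
  (forall t, A t -> 0 < d t) -> packing 0 1 s0 ->
  ((c + \sum_(e <- s0) len e)%:E < omeas A)%E ->
  exists s, [/\ packing 0 1 (s0 ++ s),
    forall e, e \in s -> [/\ A (tg e), tfine d e, perron e & rational_ends e] &
    c / 3 <= \sum_(e <- s) len e].
Proof.
move=> A01 d0 ps0 cA.
have [d1 d10 d1P] := tfine_avoid ([seq lo e | e <- s0] ++ [seq hi e | e <- s0]).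
pose d' t := Num.min (d t) (d1 t).
have pos0 e : e \in s0 -> lo e < hi e by move=> /(packing_within ps0)/and3P[].
have cA' : (c%:E < omeas (A `\` cunion s0))%E.
  rewrite -(lteD2rE _ _ (x := (\sum_(e <- s0) len e)%:E)) // -EFinD.
  apply: lt_le_trans cA _; apply: le_trans (leeD2l _ (omeas_cunion pos0)).
  apply: le_trans (omeasU _ _); apply: omeas_le => x Ax.
  by have [h|h] := pselect (cunion s0 x); [right|left].
have [||s [ps sP sl]] := vitali_selection (d := d') _ _ cA'.
- by move=> t [/A01].
- by move=> t [At _]; rewrite lt_min d0 ?d10.
have fd e : tfine d' e -> tfine d e by apply: tfine_le; rewrite ge_min lexx.
have fd1 e : tfine d' e -> tfine d1 e by apply: tfine_le; rewrite ge_min lexx orbT.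
exists s; split=> //; last first.
  by move=> e /sP[[? _] /fd ? ? ?].
apply: packing_cat => //; apply/allrelP => f e fs es.
have [[At /= nc] /fd1 fe pe _] := sP e es.
have lhf := pos0 f fs.
have /orP[tl|ht] : (tg e < lo f) || (hi f < tg e).
  apply: contra_notT nc; rewrite negb_or -!leNgt => h.
  exact: cunion_mem fs h.
- rewrite disjC /disj; apply/orP; left; rewrite leNgt; apply/negP => le.
  have /andP[? ?] := pe; have inf : lo e <= lo f <= hi e by apply/andP; split; lra.
  have := d1P e (lo f); rewrite mem_cat map_f // => /(_ isT fe inf); lra.
- rewrite /disj; apply/orP; left; rewrite leNgt; apply/negP => le.
  have /andP[? ?] := pe; have inf : lo e <= hi f <= hi e by apply/andP; split; lra.
  have := d1P e (hi f); rewrite mem_cat map_f ?orbT // => /(_ isT fe inf); lra.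
Qed.

End vitali_selection.

(** * Vitali selection on a decreasing sequence of level sets *)

Section levels.
Context {R : realType}.
Implicit Types (e f : @tagged R) (s : seq (@tagged R)) (A : nat -> set R) (d : R -> R).

Lemma omeas_fin (A : set R) : A `<=` `]0, 1[%classic -> omeas A = (fine (omeas A))%:E.
Proof.
move=> /omeas_unit h; rewrite fineK // ge0_fin_numE ?omeas_ge0 //.
by apply: le_lt_trans h _; rewrite ltry.
Qed.

(* The levels are treated from the highest down; a level that the intervals
   selected so far do not cover well enough receives new ones by Vitali. *)
Lemma levels_packing A d n : (forall k, A k `<=` `]0, 1[%classic) ->
  (forall k, A k.+1 `<=` A k) -> (forall t, A 0 t -> 0 < d t) ->
  exists s, [/\ packing 0 1 s,
    forall e, e \in s -> [/\ A 0 (tg e), tfine d e, perron e & rational_ends e] &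
    forall k, (k < n)%N ->
      fine (omeas (A k)) <= 4 * \sum_(e <- s | tg e \in A k) len e].
Proof.
elim: n A => [|n IH] A A01 Adec d0; first by exists [::].
have [|||s [ps sP sn]] := IH (fun k => A k.+1).
- by move=> k; apply: A01.
- by move=> k; apply: Adec.
- by move=> t /Adec/d0.
have sA e : e \in s -> [/\ A 0 (tg e), tfine d e, perron e & rational_ends e].
  by move=> /sP[/Adec].
pose T := \sum_(e <- s) len e; pose a := fine (omeas (A 0)).
have a0 : 0 <= a by apply: fine_ge0; exact: omeas_ge0.
have T0 : 0 <= T.
  by rewrite /T big_seq sumr_ge0 // => e /(packing_within ps)/and3P[_ /ltW]; rewrite subr_ge0.
have ET s' : (forall e, e \in s' -> A 0 (tg e)) ->
    \sum_(e <- s' | tg e \in A 0) len e = \sum_(e <- s') len e.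
  move=> h; rewrite big_mkcond /= big_seq [RHS]big_seq; apply: eq_bigr => e /h he.
  by rewrite mem_set.
have [aT|Ta] := leP a (4 * T).
  exists s; split=> // -[_|k]; last by rewrite ltnS => /sn.
  by rewrite ET // => e /sA[].
(* The missing length is a / 4 - T, and the selection returns a third of what is asked. The request
   is admissible, as 3 (a / 4 - T) + T < a. *)
have [|s' [ps' s'P s'c]] := @vitali_selection_away _ (A 0) d s (3 * (a / 4 - T)) (A01 0) d0 ps.
  by rewrite (omeas_fin (A01 0)) lte_fin -/T -/a; lra.
have all' e : e \in s ++ s' ->
    [/\ A 0 (tg e), tfine d e, perron e & rational_ends e].
  by rewrite mem_cat => /orP[/sA|/s'P].
exists (s ++ s'); split=> // -[_|k].
  rewrite ET; last by move=> e /all'[].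
  by rewrite big_cat /= -/T -/a; lra.
rewrite ltnS => /sn h; apply: le_trans h _; rewrite big_cat /= mulrDr lerDl.
rewrite mulr_ge0 // big_seq_cond sumr_ge0 // => e /andP[es _].
have es' : e \in s ++ s' by rewrite mem_cat es orbT.
by have /and3P[_ /ltW] := packing_within ps' es'; rewrite subr_ge0.
Qed.

(** The open intervals are cut out of [O] one at a time, and the rest of the packing remains inside
    what is left. *)
Lemma sum_len_omeas (O : set R) s : measurable O -> packing 0 1 s ->
  (forall e x, e \in s -> lo e < x < hi e -> O x) ->
  ((\sum_(e <- s) len e)%:E <= omeas O)%E.
Proof.
elim: s O => [|e s IH] O mO; first by rewrite big_nil omeas_ge0.
rewrite packing_cons => /and3P[/and3P[_ lh _] /allP de ps] sO.
have mI : measurable (`]lo e, hi e[%classic : set R) by exact: measurable_itv.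
have -> : omeas O = (omeas (O `\` `]lo e, hi e[%classic) + omeas (O `&` `]lo e, hi e[%classic))%E.
  by apply: (measureDI (@lebesgue_measure R)).
rewrite big_cons addrC EFinD; apply: leeD.
  apply: IH => //; first exact: measurableD.
  move=> f x fs /andP[fx xf]; split; first by apply: (sO f); rewrite ?inE ?fs ?orbT ?fx.
  rewrite /= in_itv /= => /andP[ex xe].
  by have := de f fs; rewrite /disj => /orP[]; rewrite leNgt; apply/negP/negPn; lra.
have -> : O `&` `]lo e, hi e[%classic = `]lo e, hi e[%classic.
  apply/setIidPr => x /=; rewrite in_itv /=; apply: sO.
  exact: mem_head.
by rewrite omeas_oo.
Qed.

(** A geometric sum with ratio 2 is at most twice its last term, and that term is below h. *)
Lemma sum_pow2_le (c h : R) n : 0 <= c -> 0 <= h ->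
  \sum_(k < n | c * 2 ^+ k < h) c * 2 ^+ k <= 2 * h.
Proof.
move=> c0 h0; elim: n => [|n IH]; first by rewrite big_ord0 mulr_ge0.
have [lt|ge] := ltP (c * 2 ^+ n) h; last first.
  by rewrite big_mkcond big_ord_recr /= ltNge ge addr0 -big_mkcond.
have geo m : \sum_(k < m) c * 2 ^+ k <= c * 2 ^+ m.
  elim: m => [|m IHm]; first by rewrite big_ord0 expr0 mulr1.
  by rewrite big_ord_recr /= exprS; move: IHm; set x := \sum_(_ < m) _; lra.
apply: (@le_trans _ _ (\sum_(k < n.+1) c * 2 ^+ k)).
  rewrite big_mkcond; apply: ler_sum => k _; case: ifP => // _.
  by rewrite mulr_ge0 ?exprn_ge0.
by apply: le_trans (geo _) _; rewrite exprS; lra.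
Qed.

(** One packing from [levels_packing] serves all levels at once. After exchanging the sums, an
    interval tagged at t has weight at most 2 h(t) by [sum_pow2_le], so the bound is 4 times 2. *)
Lemma levels_sum (h : R -> R) d (eps : R) : 0 < eps ->
  (forall t, 0 < t < 1 -> 0 <= h t) -> (forall t, 0 < t < 1 -> 0 < d t) ->
  (forall s, packing 0 1 s ->
     (forall e, e \in s -> [/\ 0 < tg e < 1, tfine d e, perron e & rational_ends e]) ->
     \sum_(e <- s) h (tg e) * len e <= eps) ->
  forall n, \sum_(k < n) 2 ^+ k *
    fine (omeas [set t | 0 < t < 1 /\ eps * 2 ^+ k < h t]) <= 8.
Proof.
move=> eps0 h0 d0 H n.
pose A k := [set t | 0 < t < 1 /\ eps * 2 ^+ k < h t].
have [|||s [ps sP sA]] := @levels_packing A d n.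
- by move=> k t [] /=; rewrite in_itv.
- move=> k t [t01 le]; split=> //; apply: le_lt_trans le.
  by rewrite ler_wpM2l ?(ltW eps0) // exprS ler_peMl ?exprn_ge0 //; lra.
- by move=> t [/d0].
have Hs : \sum_(e <- s) h (tg e) * len e <= eps by apply: H => // e /sP[[]].
rewrite -(ler_pM2l eps0).
apply: (@le_trans _ _ (8 * \sum_(e <- s) h (tg e) * len e)); last by lra.
apply: (@le_trans _ _ (\sum_(k < n) eps * 2 ^+ k * (4 * \sum_(e <- s | tg e \in A k) len e))).
  rewrite mulr_sumr; apply: ler_sum => k _; rewrite [leLHS]mulrA ler_wpM2l ?sA //.
  by rewrite mulr_ge0 ?exprn_ge0 // ltW.
under eq_bigr do rewrite big_mkcond /= mulrCA mulr_sumr.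
rewrite -mulr_sumr exchange_big /=.
have -> : 8 = 4 * 2 :> R by lra.
rewrite -[leRHS]mulrA ler_wpM2l // mulr_sumr big_seq [leRHS]big_seq.
apply: ler_sum => e es.
have /and3P[_ lh _] := packing_within ps es.
have len0 : 0 <= len e by rewrite subr_ge0 ltW.
have [[t01 _] _ _ _] := sP e es.
apply: (@le_trans _ _ ((\sum_(k < n | eps * 2 ^+ k < h (tg e)) eps * 2 ^+ k) * len e)).
  rewrite mulr_suml [leRHS]big_mkcond /=; apply: ler_sum => k _.
  have -> : (tg e \in A k) = (eps * 2 ^+ k < h (tg e)).
    by apply/idP/idP => [|lt]; [rewrite inE => -[]|rewrite inE; split].
  by case: ifP => _; rewrite ?mulr0.
by rewrite mulrA ler_wpM2r // sum_pow2_le ?(ltW eps0) // h0.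
Qed.

End levels.

(** * From small Henstock sums to small McShane sums of a nonnegative function *)

Section small_sums.
Context {R : realType}.
Implicit Types (e f : @tagged R) (s : seq (@tagged R)) (d h : R -> R).

Lemma sum_len_tag d s t : packing 0 1 s -> 0 <= d t ->
  (forall e, e \in s -> tfine d e) -> \sum_(e <- s | tg e == t) len e <= 2 * d t.
Proof.
move=> ps dt fs; rewrite -big_filter.
have -> : 2 * d t = (t + d t) - (t - d t) by lra.
apply: sum_len_le; first by lra.
apply: packing_restrict ps _ => e es /eqP <-.
by have /andP[] := fs e es.
Qed.

Lemma dyadic_level (c x : R) : 0 < c -> c < x ->
  exists j, c * 2 ^+ j < x /\ x <= c * 2 ^+ j.+1.
Proof.
move=> c0 cx.
have ex : exists j, x <= c * 2 ^+ j.+1.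
  have [n xn] : exists n : nat, x / c <= n%:R.
    by exists (Num.truncn (x / c)).+1; rewrite ltW // truncnS_gt.
  exists n; rewrite mulrC -ler_pdivrMr // (le_trans xn) // -natrX ler_nat.
  apply: ltnW; apply: (@leq_trans (2 ^ n)%N); first exact: ltn_expl.
  by rewrite leq_pexp2l.
exists (ex_minn ex); case: ex_minnP => -[|j] xj mn; split=> //.
  by rewrite expr0 mulr1.
by rewrite ltNge; apply/negP => /mn; rewrite ltnn.
Qed.

Lemma sum_half_pow n : \sum_(j < n) (2 ^+ j)^-1 <= 2 :> R.
Proof.
(* Adding the tail of the series makes the induction go through. *)
suff : \sum_(j < n) (2 ^+ j)^-1 + 2 * (2 ^+ n)^-1 <= 2 :> R.
  have : 0 <= (2 ^+ n)^-1 :> R by rewrite invr_ge0 exprn_ge0.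
  by lra.
elim: n => [|n]; first by rewrite big_ord0 expr0 invr1; lra.
rewrite big_ord_recr /= exprS invfM; set x := \sum_(_ < _) _.
by set y := (_ ^+ _)^-1; lra.
Qed.

(* The level sets of h have outer measures with a small weighted sum by Vitali,
   and tags in a level set may be confined to an open superset of it. *)
Lemma small_henstock_small_mcshane h d (eps : R) : 0 < eps ->
  (forall t, 0 <= t <= 1 -> 0 <= h t) -> (forall t, 0 < t < 1 -> 0 < d t) ->
  (forall s, packing 0 1 s ->
     (forall e, e \in s -> [/\ 0 < tg e < 1, tfine d e, perron e & rational_ends e]) ->
     \sum_(e <- s) h (tg e) * len e <= eps) ->
  exists2 d' : R -> R, (forall t, 0 < d' t) &
    forall s, packing 0 1 s ->
      (forall e, e \in s -> 0 <= tg e <= 1 /\ tfine d' e) ->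
      \sum_(e <- s) h (tg e) * len e <= 25 * eps.
Proof.
move=> eps0 h0 d0 H.
have h0' t : 0 < t < 1 -> 0 <= h t by move=> /andP[/ltW t0 /ltW t1]; rewrite h0 ?t0.
have small := levels_sum eps0 h0' d0 H.
pose A k := [set t | 0 < t < 1 /\ eps * 2 ^+ k < h t].
have A01 k : A k `<=` `]0, 1[%classic by move=> t [t01 _]; rewrite /= in_itv.
pose a k := fine (omeas (A k)).
(* The excess measure of the open superset of level k; after multiplication by the weight 2^k of the
   level it is still summable. *)
pose err k : R := (2 ^+ k)^-1 * (2 ^+ k)^-1.
have errp k : 0 < err k by rewrite mulr_gt0 // invr_gt0 exprn_gt0.
have [V VP] := choice (fun k => outer_measure_open_le (A k) (errp k)).
pose act t := (0 < t < 1) && (eps < h t).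
have ex_lev t : exists j, act t -> eps * 2 ^+ j < h t /\ h t <= eps * 2 ^+ j.+1.
  have [/andP[_ et]|nt] := boolP (act t); last by exists 0%N.
  by have [j] := dyadic_level eps0 et; exists j.
have [lev levP] := choice ex_lev.
(* The radius has two duties: it bounds the total contribution of a single tag, needed at 0 and 1,
   and it keeps intervals with tag at level j inside the open set [V j]. *)
have ex_d t : exists r, [/\ 0 < r, r * `|h t| <= eps &
    act t -> forall x, t - r <= x <= t + r -> V (lev t) x].
  have hp : 0 < `|h t| + 1 by rewrite ltr_wpDl.
  have hb r : 0 < r -> r <= eps / (`|h t| + 1) -> r * `|h t| <= eps.
    move=> r0; rewrite ler_pdivlMr //; apply: le_trans.
    by rewrite ler_wpM2l ?(ltW r0) //; lra.
  have q0 : 0 < eps / (`|h t| + 1) by rewrite divr_gt0.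
  have [at_|nat_] := boolP (act t); last first.
    by exists (eps / (`|h t| + 1)); split=> //; apply: hb.
  have [oO AV _] := VP (lev t).
  have /AV Ot : A (lev t) t by split; [case/andP: at_|case: (levP t at_)].
  have /nbhs_ballP[r /= r0 rO] := open_nbhs_nbhs (conj oO Ot).
  have m0 : 0 < Num.min (r / 2) (eps / (`|h t| + 1)) by rewrite lt_min q0 divr_gt0.
  exists (Num.min (r / 2) (eps / (`|h t| + 1))); split=> //.
    by apply: hb => //; rewrite ge_min lexx orbT.
  move=> _ x xt; apply: rO; rewrite -ball_normE /= ltr_norml.
  have : Num.min (r / 2) (eps / (`|h t| + 1)) <= r / 2 by rewrite ge_min lexx.
  by move: xt => /andP[? ?] ?; apply/andP; split; lra.
have [d' d'P] := choice ex_d.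
exists d' => [t|s ps sP]; first by case: (d'P t).
have fs e : e \in s -> tfine d' e by move=> /sP[].
have len0 e : e \in s -> 0 <= len e.
  by move=> /(packing_within ps)/and3P[_ /ltW]; rewrite subr_ge0.
pose g0 e := if tg e == 0 then h 0 * len e else 0.
pose g1 e := if tg e == 1 then h 1 * len e else 0.
pose K := (\max_(e <- s) lev (tg e)).+1.
pose gl e := \sum_(j < K) if act (tg e) && (lev (tg e) == j) then
   eps * 2 ^+ j.+1 * len e else 0.
(* The four terms cover tags with h at most eps, the tag 0, the tag 1, and the dyadic levels. Their
   sums are bounded by eps, 2 eps, 2 eps and 20 eps. *)
have ptw e : e \in s -> h (tg e) * len e <= eps * len e + g0 e + g1 e + gl e.
  move=> es; have le0 := len0 e es.
  have [/andP[t0 t1] _] := sP e es.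
  have gl0 : 0 <= gl e.
    rewrite /gl sumr_ge0 // => j _; case: ifP => // _.
    by rewrite !mulr_ge0 ?exprn_ge0 // ltW.
  have el0 : 0 <= eps * len e by rewrite mulr_ge0 ?(ltW eps0).
  have h00 : 0 <= h 0 * len e by rewrite mulr_ge0 // h0 // lexx ler01.
  have h10 : 0 <= h 1 * len e by rewrite mulr_ge0 // h0 // lexx ler01.
  have g00 : 0 <= g0 e by rewrite /g0; case: ifP.
  have g10 : 0 <= g1 e by rewrite /g1; case: ifP.
  have [e0|n0] := eqVneq (tg e) 0.
    have -> : g0 e = h (tg e) * len e by rewrite /g0 e0 eqxx.
    by lra.
  have [e1|n1] := eqVneq (tg e) 1.
    have -> : g1 e = h (tg e) * len e by rewrite /g1 e1 eqxx.
    by lra.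
  have t01 : 0 < tg e < 1 by rewrite !lt_neqAle eq_sym n0 n1 t0 t1.
  have [hle|hgt] := leP (h (tg e)) eps.
    have : h (tg e) * len e <= eps * len e by rewrite ler_wpM2r.
    by lra.
  have at_ : act (tg e) by rewrite /act t01 hgt.
  suff : h (tg e) * len e <= gl e by lra.
  have lK : (lev (tg e) < K)%N.
    by rewrite ltnS /K (big_rem e) //= leq_maxl.
  rewrite /gl (bigD1 (Ordinal lK)) //= at_ eqxx /=.
  have [_ hl] := levP _ at_.
  have h1 : h (tg e) * len e <= eps * 2 ^+ (lev (tg e)).+1 * len e by rewrite ler_wpM2r.
  apply: le_trans h1 _; rewrite lerDl sumr_ge0 // => j _; case: ifP => // _.
  by rewrite !mulr_ge0 ?exprn_ge0 // ltW.
have tagb t (ht : 0 <= h t) : \sum_(e <- s | tg e == t) h t * len e <= 2 * eps.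
  have [dp dh _] := d'P t.
  rewrite -mulr_sumr; have := sum_len_tag ps (ltW dp) fs.
  move=> /(ler_wpM2l ht) /le_trans; apply.
  by rewrite mulrCA ler_pM2l // mulrC; rewrite ger0_norm in dh.
(* The outer measures of the levels give 16 eps by [levels_sum], and the excesses of the open sets
   give 4 eps. *)
have glb : \sum_(e <- s) gl e <= 20 * eps.
  rewrite /gl exchange_big /=.
  apply: (@le_trans _ _ (\sum_(j < K) (2 * eps * (2 ^+ j * a j) + 2 * eps * (2 ^+ j)^-1))).
    apply: ler_sum => j _; rewrite -big_mkcond -mulr_sumr /=.
    have -> : 2 * eps * (2 ^+ j * a j) + 2 * eps * (2 ^+ j)^-1 =
              eps * 2 ^+ j.+1 * (a j + err j).
      rewrite /err exprS; field; by rewrite expf_neq0.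
    rewrite ler_wpM2l ?mulr_ge0 ?exprn_ge0 ?(ltW eps0) // -lee_fin.
    have [oO _ /(le_trans _)] := VP j.
    rewrite -[X in (X + _)%E]/(omeas (A j)) (omeas_fin (A01 j)) -EFinD; apply.
    rewrite -big_filter; apply: sum_len_omeas; first exact: measurable_realfun.open_measurable.
      exact: packing_filter.
    move=> e x; rewrite mem_filter => /andP[/andP[at_ /eqP <-] es] /andP[ex xe].
    have [_ _] := d'P (tg e); apply=> //.
    by have /andP[? ?] := fs e es; apply/andP; split; lra.
  rewrite big_split /= -!mulr_sumr.
  have := ler_wpM2l (ltW eps0) (small K).
  have := ler_wpM2l (ltW eps0) (sum_half_pow K).
  set x := \sum_(_ < _) _; set y := \sum_(_ < _) _; lra.
have e1 : \sum_(e <- s) eps * len e <= eps.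
  rewrite -mulr_sumr ger_pMr //; have := sum_len_le (@ler01 R) ps; lra.
have e2 : \sum_(e <- s) g0 e <= 2 * eps.
  by rewrite -big_mkcond; apply: tagb; rewrite h0 // lexx ler01.
have e3 : \sum_(e <- s) g1 e <= 2 * eps.
  by rewrite -big_mkcond; apply: tagb; rewrite h0 // lexx ler01.
apply: (@le_trans _ _ (\sum_(e <- s) (eps * len e + g0 e + g1 e + gl e))).
  by rewrite big_seq [leRHS]big_seq; apply: ler_sum => e /ptw.
rewrite !big_split /=; lra.
Qed.

End small_sums.

(** * From partitions to lists of tagged intervals *)

Section partitions.
Context {R : realType}.
Implicit Types (e f : @tagged R) (s : seq (@tagged R)) (d : R -> R).

Lemma interior_cc (a b : R) : (`[a, b]%classic : set R)° = `]a, b[%classic.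
Proof. exact: interior_itv_bnd. Qed.

Lemma subintervals_cc (a b : R) : 0 <= a -> a <= b -> b <= 1 -> subintervals `[a, b]%classic.
Proof. by move=> *; exists a, b. Qed.

Lemma nonoverlapping_cc (a b x y : R) : b <= x ->
  nonoverlapping (`[a, b]%classic : set R) `[x, y]%classic.
Proof.
move=> bx; rewrite /nonoverlapping !interior_cc; apply/seteqP; split=> // z [/=].
rewrite !in_itv /= => /andP[_ zb] /andP[xz _].
by have := lt_le_trans zb (le_trans bx (ltW xz)); rewrite ltxx.
Qed.

Lemma length_cc (a b : R) : a <= b -> length (`[a, b]%classic : set R) = b - a.
Proof. by move=> ab; rewrite /length -omeas_lebesgue omeas_cc. Qed.

Lemma setU_cc (a b c : R) : a <= b -> b <= c ->
  (`[a, b]%classic `|` `[b, c]%classic : set R) = `[a, c]%classic.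
Proof.
move=> ab bc; apply/seteqP; split=> x /=; rewrite !in_itv /=.
  by move=> [|] /andP[? ?]; apply/andP; split; lra.
move=> /andP[ax xc]; case/orP: (le_total x b) => h; [left|right]; exact/andP.
Qed.

Lemma chain_cover (a b x : R) s : chain a s b -> a < b -> a <= x <= b ->
  exists2 e, e \in s & lo e <= x <= hi e.
Proof.
elim: s a => [|e s IH] a /=; first by move=> /eqP ->; rewrite ltxx.
move=> /and3P[/eqP ea lh cs] ab /andP[ax xb].
have [xh|hx] := leP x (hi e); first by exists e; rewrite ?mem_head // ea ax xh.
have [||f fs h] := IH _ cs; [exact: lt_le_trans xb|by rewrite (ltW hx)|].
by exists f; rewrite // inE fs orbT.
Qed.

Definition tag_itv e : set R := `[lo e, hi e]%classic.

Definition seq_itv s (i : 'I_(size s)) : set R := tag_itv (tnth (in_tuple s) i).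
Definition seq_tag s (i : 'I_(size s)) : R := tg (tnth (in_tuple s) i).

Lemma chain_partition s : chain 0 s 1 -> interval_partition (@seq_itv s).
Proof.
move=> cs; have ps := chain_packing cs; split.
- move=> i; have /and3P[? ? ?] := packing_within ps (mem_tnth i (in_tuple s)).
  by apply: subintervals_cc => //; apply: ltW.
- move=> i j ij; have e0 : @tagged R := ((0, 0), 0).
  have dij : disj (tnth (in_tuple s) i) (tnth (in_tuple s) j).
    rewrite !(tnth_nth e0) /=.
    have /andP[_ /(pairwiseP e0) pw] := ps.
    have [lt|gt|/val_inj eq] := ltngtP i j; last by rewrite eq eqxx in ij.
      by apply: pw => //; rewrite inE.
    by rewrite disjC; apply: pw => //; rewrite inE.
  case/orP: dij => h; first exact: nonoverlapping_cc.
  by rewrite /nonoverlapping setIC; apply: nonoverlapping_cc.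
- apply/seteqP; split=> x /=.
    move=> [i _]; rewrite /seq_itv /tag_itv /unit_itv /= !in_itv /=.
    have /and3P[? ? ?] := packing_within ps (mem_tnth i (in_tuple s)).
    by move=> /andP[? ?]; apply/andP; split; lra.
  rewrite /unit_itv /= in_itv /= => /(chain_cover cs ltr01)[e es h].
  have /tnthP[i ei] : e \in in_tuple s by [].
  by exists i => //; rewrite /seq_itv /tag_itv -ei /= in_itv.
Qed.

Lemma chain_tagged_partition s : chain 0 s 1 ->
  (forall e, e \in s -> 0 <= tg e <= 1) -> tagged_partition (@seq_itv s) (@seq_tag s).
Proof.
move=> cs ts; split; first exact: chain_partition.
by move=> i; rewrite /unit_itv /= in_itv /=; apply/ts/(mem_tnth i (in_tuple s)).
Qed.

Lemma chain_perron_partition s : chain 0 s 1 ->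
  (forall e, e \in s -> perron e) -> perron_partition (@seq_itv s) (@seq_tag s).
Proof.
move=> cs ts; split; last first.
  move=> i; rewrite /seq_itv /tag_itv /= in_itv /=.
  exact: (ts _ (mem_tnth i (in_tuple s))).
apply: chain_tagged_partition => // e es.
have /and3P[? ? ?] := packing_within (chain_packing cs) es.
by have /andP[? ?] := ts e es; apply/andP; split; lra.
Qed.

Lemma seq_fine_for s d : (forall e, e \in s -> tfine d e) ->
  fine_for d (@seq_itv s) (@seq_tag s).
Proof.
move=> fs i x; rewrite /seq_itv /seq_tag /tag_itv /= !in_itv /=.
have /andP[] := fs _ (mem_tnth i (in_tuple s)); set e := tnth _ _.
by move=> h1 h2 /andP[h3 h4]; rewrite (le_trans h1 h3) (le_trans h4 h2).
Qed.

Lemma sum_seq_itv s (F : @tagged R -> R) :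
  \sum_(i < size s) F (tnth (in_tuple s) i) = \sum_(e <- s) F e.
Proof. by rewrite (big_tnth _ _ s). Qed.

(* Degenerate intervals, which may repeat or lie inside others, are dropped. *)
Lemma partition_packing (p : nat) (I : 'I_p -> set R) (t : 'I_p -> R) :
  interval_partition I ->
  exists l r : 'I_p -> R, [/\ forall i, [/\ 0 <= l i, l i <= r i & r i <= 1],
    forall i, I i = `[l i, r i]%classic &
    packing 0 1 [seq ((l i, r i), t i) | i <- enum 'I_p & l i < r i]].
Proof.
move=> [sI nI _].
have ex i : exists lr : R * R, [/\ 0 <= lr.1, lr.1 <= lr.2, lr.2 <= 1 &
    I i = `[lr.1, lr.2]%classic].
  by have [a [b [? ? ? ?]]] := sI i; exists (a, b).
have [lr lrP] := choice ex.
exists (fun i => (lr i).1), (fun i => (lr i).2); split.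
- by move=> i; have [] := lrP i.
- by move=> i; have [] := lrP i.
apply/andP; split.
  apply/allP => e /mapP[i]; rewrite mem_filter => /andP[h _] ->.
  by have [h0 _ h1 _] := lrP i; apply/and3P.
rewrite pairwise_map.
have : pairwise (fun i j : 'I_p => i != j) [seq i <- enum 'I_p | (lr i).1 < (lr i).2].
  by rewrite -uniq_pairwise filter_uniq // enum_uniq.
apply: (sub_in_pairwise (P := [pred i | (lr i).1 < (lr i).2])); last exact: filter_all.
move=> i j; rewrite !inE /disj /lo /hi /= => hi_ hj ij.
have [_ _ _ Ii] := lrP i; have [_ _ _ Ij] := lrP j.
apply/negPn; rewrite negb_or -!ltNge; apply/negP => /andP[h1 h2].
have := nI i j ij; rewrite /nonoverlapping Ii Ij !interior_cc.
pose m := Num.max (lr i).1 (lr j).1; pose M := Num.min (lr i).2 (lr j).2.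
have mM : m < M by rewrite gt_max !lt_min hi_ hj h1 h2.
have : (lr i).1 <= m /\ (lr j).1 <= m by rewrite !le_max !lexx orbT.
have : M <= (lr i).2 /\ M <= (lr j).2 by rewrite !ge_min !lexx orbT.
move=> [? ?] [? ?] /seteqP[/(_ ((m + M) / 2)) sub _]; apply: sub.
by split; rewrite /= in_itv /=; apply/andP; split; lra.
Qed.

Lemma sum_partition_packing (p : nat) (l r t : 'I_p -> R) (F : @tagged R -> R) :
  (forall i, l i <= r i) -> (forall i, F ((l i, l i), t i) = 0) ->
  \sum_(i < p) F ((l i, r i), t i) =
  \sum_(e <- [seq ((l i, r i), t i) | i <- enum 'I_p & l i < r i]) F e.
Proof.
move=> lr F0; rewrite big_map big_filter big_enum_cond /= [RHS]big_mkcond /=.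
apply: eq_bigr => i _; case: ifP => // /negbT; rewrite -leNgt => rl.
by have -> : r i = l i; [apply/le_anti; rewrite lr rl|rewrite F0].
Qed.

End partitions.

(** * Interval multimeasures seen through real interval functions, and integrability in terms of
    packings *)

Section interval_functions.
Context {R : realType} {X : normedModType R}.
Context (Gamma : R -> set X) (Phi : set R -> set X).
Context (Gamma_cb : forall t, unit_itv t -> cb (Gamma t)).
Context (Phi_im : interval_multimeasure Phi).
Implicit Types (e : @tagged R) (s : seq (@tagged R)) (C D : set X).

(** How far [Phi] is over [a, b] from the primitive of the constant multifunction [C]; for [C] = {0}
    this is the norm of [Phi] there. *)
Definition dev C (a b : R) : R := hdist (Phi `[a, b]%classic) (scale_set (b - a) C).
Definition err e : R := dev (Gamma (tg e)) (lo e) (hi e).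

Lemma Phi_bounded (a b : R) : 0 <= a -> a <= b -> b <= 1 ->
  bounded_convex (Phi `[a, b]%classic).
Proof. by move=> *; apply/cb_bounded_convex/(proj1 Phi_im)/subintervals_cc. Qed.

Lemma Gamma_bounded t : 0 <= t <= 1 -> bounded_convex (Gamma t).
Proof. by move=> ht; apply/cb_bounded_convex/Gamma_cb; rewrite /unit_itv /= in_itv. Qed.

Lemma Phi_add (a b c : R) : 0 <= a -> a <= b -> b <= c -> c <= 1 ->
  Phi `[a, c]%classic =
  closure (minkowski_sum (Phi `[a, b]%classic) (Phi `[b, c]%classic)).
Proof.
move=> a0 ab bc c1; rewrite -(setU_cc ab bc); apply: (proj2 Phi_im).
- by apply: subintervals_cc => //; apply: le_trans c1.
- by apply: subintervals_cc => //; apply: le_trans ab.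
- by rewrite setU_cc //; apply: subintervals_cc => //; apply: le_trans bc.
- exact: nonoverlapping_cc.
Qed.

Lemma dev_ge0 C a b : 0 <= a -> a <= b -> b <= 1 -> 0 <= dev C a b.
Proof. by move=> a0 ab b1; apply: hdist_ge0; have [] := Phi_bounded a0 ab b1. Qed.

Lemma dev_subadd C a b c : bounded_convex C -> 0 <= a -> a <= b -> b <= c -> c <= 1 ->
  dev C a c <= dev C a b + dev C b c.
Proof.
move=> bC a0 ab bc c1; rewrite /dev (Phi_add a0 ab bc c1).
have -> : c - a = (b - a) + (c - b) by lra.
apply: hdist_closure_add; rewrite ?subr_ge0 //.
- by apply/bounded_convexW/Phi_bounded => //; apply: le_trans c1.
- by apply/bounded_convexW/Phi_bounded => //; apply: le_trans ab.
Qed.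

(** Additivity for [a, a] united with itself makes the value of [Phi] there idempotent, hence of
    norm zero. *)
Lemma dev_diag C a : C !=set0 -> 0 <= a -> a <= 1 -> dev C a a = 0.
Proof.
move=> C0 a0 a1; rewrite /dev subrr scale_set0r //; apply: hdist_idempotent.
  exact/bounded_convexW/Phi_bounded.
exact: Phi_add.
Qed.

Lemma dev_le C D a b : bounded_convex C -> bounded_convex D ->
  0 <= a -> a <= b -> b <= 1 -> dev C a b <= dev D a b + (b - a) * hdist C D.
Proof.
move=> bC bD a0 ab b1.
have bP := bounded_convexW (Phi_bounded a0 ab b1).
have [cC cD] := (bounded_convexW bC, bounded_convexW bD).
apply: le_trans (hdist_triangle bP (bounded_nonempty_scale (b - a) cD) _) _.
  exact: bounded_nonempty_scale.
rewrite lerD2l (hdistC C).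
by have := hdist_scale (b - a) cD cC; rewrite ger0_norm ?subr_ge0.
Qed.

(** Triangle inequality through [Phi], after rescaling. If two constants both fit [Phi] well on an
    interval, they are close to each other. *)
Lemma hdist_le_dev C D a b : bounded_convex C -> bounded_convex D ->
  0 <= a -> a < b -> b <= 1 -> (b - a) * hdist C D <= dev C a b + dev D a b.
Proof.
move=> bC bD a0 ab b1.
have bP := bounded_convexW (Phi_bounded a0 (ltW ab) b1).
have [cC cD] := (bounded_convexW bC, bounded_convexW bD).
have k0 : 0 < b - a by rewrite subr_gt0.
have := hdist_scale_diff k0 cC (bounded_nonempty_scale (b - a) cD).
rewrite scale_set_comp mulVf ?gt_eqF // scale_set1 => /le_trans; apply.
rewrite /dev (hdistC _ (scale_set _ C)).
by apply: hdist_triangle => //; apply: bounded_nonempty_scale.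
Qed.

Lemma err_ge0 e : within 0 1 e -> 0 <= err e.
Proof. by move=> /and3P[? /ltW ? ?]; apply: dev_ge0. Qed.

Lemma integral_error_sum (p : nat) (l r t : 'I_p -> R) (I : 'I_p -> set R) :
  (forall i, [/\ 0 <= l i, l i <= r i & r i <= 1]) ->
  (forall i, I i = `[l i, r i]%classic) -> (forall i, 0 <= t i <= 1) ->
  integral_error Gamma Phi I t = (\sum_(i < p) err ((l i, r i), t i))%:E.
Proof.
move=> lr Ii t01; rewrite /integral_error -sumEFin; apply: eq_bigr => i _.
have [l0 lri r1] := lr i.
rewrite Ii length_cc // hausdorff_dist_fin //.
  exact/bounded_convexW/Phi_bounded.
exact/bounded_nonempty_scale/bounded_convexW/Gamma_bounded.
Qed.

Lemma integral_error_chain s : chain 0 s 1 -> (forall e, e \in s -> 0 <= tg e <= 1) ->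
  integral_error Gamma Phi (@seq_itv _ s) (@seq_tag _ s) = (\sum_(e <- s) err e)%:E.
Proof.
move=> cs ts; rewrite (integral_error_sum (l := fun i => lo (tnth (in_tuple s) i))
  (r := fun i => hi (tnth (in_tuple s) i))) //.
- by rewrite -sum_seq_itv; congr (_%:E); apply: eq_bigr => i _; case: tnth => -[].
- move=> i; have /and3P[? ? ?] := packing_within (chain_packing cs) (mem_tnth i (in_tuple s)).
  by split=> //; apply: ltW.
- by move=> i; apply/ts/(mem_tnth i (in_tuple s)).
Qed.

Lemma sum_le_perm s r s' (F : @tagged R -> R) : perm_eq (s ++ r) s' ->
  (forall e, e \in s' -> 0 <= F e) -> \sum_(e <- s) F e <= \sum_(e <- s') F e.
Proof.
move=> pr F0; rewrite -(sum_perm F pr) big_cat /= lerDl big_seq sumr_ge0 // => e er.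
by apply: F0; rewrite -(perm_mem pr) mem_cat er orbT.
Qed.

(** A fine Perron packing extends to a full partition by Cousin's lemma, and the added errors are
    nonnegative. *)
Lemma henstock_packings : vH_integral Gamma Phi -> forall eps : R, 0 < eps ->
  exists2 d : R -> R, (forall t, 0 < d t) &
    forall s, packing 0 1 s -> (forall e, e \in s -> tfine d e /\ perron e) ->
      \sum_(e <- s) err e <= eps.
Proof.
move=> [_ vH] eps /vH[d [gd dP]].
(* A gauge is positive on [0, 1] only; the value 1 makes it positive everywhere. *)
pose d' t := if 0 <= t <= 1 then d t else 1.
have d'0 t : 0 < d' t.
  by rewrite /d'; case: ifP => // h; apply: gd; rewrite /unit_itv /= in_itv.
exists d' => // s ps sP.
have [e _ fe pe||s' [r [cs' as' pr]]] := packing_extend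
    (Q := fun e => tfine d' e && perron e) (fun t _ _ => d'0 t) _ ler01 ps.
- exact/andP.
- by apply/allP => e /sP[-> ->].
have us' e : e \in s' -> [/\ tfine d e, perron e & 0 <= tg e <= 1].
  move=> es; have /and3P[? ? ?] := packing_within (chain_packing cs') es.
  have /andP[fe pe] := allP as' e es; have /andP[? ?] := pe.
  have te : 0 <= tg e <= 1 by apply/andP; split; lra.
  by split=> //; move: fe; rewrite /tfine /d' te.
apply: (@le_trans _ _ (\sum_(e <- s') err e)).
  by apply: sum_le_perm pr _ => e /(packing_within (chain_packing cs'))/err_ge0.
rewrite -lee_fin -integral_error_chain //; last by move=> e /us'[].
apply/ltW/dP; first by apply: chain_perron_partition => // e /us'[].
by apply: seq_fine_for => e /us'[].
Qed.

Definition small_mcshane_sums := forall eps : R, 0 < eps ->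
  exists2 d : R -> R, (forall t, 0 < d t) &
    forall s, packing 0 1 s -> (forall e, e \in s -> tfine d e /\ 0 <= tg e <= 1) ->
      \sum_(e <- s) err e <= eps.

Lemma mcshane_packings : vM_integral Gamma Phi -> small_mcshane_sums.
Proof.
move=> [_ vM] eps /vM[d [gd dP]].
pose d' t := if 0 <= t <= 1 then d t else 1.
have d'0 t : 0 < d' t.
  by rewrite /d'; case: ifP => // h; apply: gd; rewrite /unit_itv /= in_itv.
exists d' => // s ps sP.
have [e /and3P[? ? ?] fe pe||s' [r [cs' as' pr]]] := packing_extend
    (Q := fun e => tfine d' e && (0 <= tg e <= 1)) (fun t _ _ => d'0 t) _ ler01 ps.
- by rewrite fe /=; move: pe => /andP[? ?]; apply/andP; split; lra.
- by apply/allP => e /sP[-> ->].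
have us' e : e \in s' -> tfine d e /\ 0 <= tg e <= 1.
  move=> es; have /andP[fe te] := allP as' e es.
  by split=> //; move: fe; rewrite /tfine /d' te.
apply: (@le_trans _ _ (\sum_(e <- s') err e)).
  by apply: sum_le_perm pr _ => e /(packing_within (chain_packing cs'))/err_ge0.
rewrite -lee_fin -integral_error_chain //; last by move=> e /us'[].
apply/ltW/dP; first by apply: chain_tagged_partition => // e /us'[].
by apply: seq_fine_for => e /us'[].
Qed.

(** Degenerate intervals of a partition have zero error by [dev_diag], so only its packing matters;
    halving eps yields the strict inequality. *)
Lemma vM_integral_packings : small_mcshane_sums -> vM_integral Gamma Phi.
Proof.
move=> H; split=> // eps eps0.
have e2 : 0 < eps / 2 by lra.
have [d d0 dP] := H _ e2.
exists d; split=> [t _//|p I t [Ip t01] fI].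
have t01' i : 0 <= t i <= 1 by have := t01 i; rewrite /unit_itv /= in_itv.
have [l [r [lr Ii ps]]] := partition_packing t Ip.
rewrite (integral_error_sum lr Ii t01') lte_fin.
rewrite (sum_partition_packing (F := err)); last 2 first.
- by move=> i; have [] := lr i.
- move=> i; rewrite /err; have [? ? ?] := lr i; apply: dev_diag => //.
    by have [] := Gamma_bounded (t01' i).
  by rewrite /lo /=; lra.
apply: (@le_lt_trans _ _ (eps / 2)); last by lra.
apply: dP => // e /mapP[i]; rewrite mem_filter => /andP[lri _] ->.
split; last exact: t01'.
have := fI i; rewrite Ii /tfine /lo /hi /tg /= => sub.
have := sub (l i); have := sub (r i); rewrite /= !in_itv /= lexx (ltW lri) lexx.
by move=> /(_ isT)/andP[_ ->] /(_ isT)/andP[->].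
Qed.

Definition var_bound (V : R) :=
  forall s, packing 0 1 s -> \sum_(e <- s) dev [set 0] (lo e) (hi e) <= V.

Lemma set_norm_cc (a b : R) : 0 <= a -> a <= b -> b <= 1 ->
  set_norm (Phi `[a, b]%classic) = (dev [set 0] a b)%:E.
Proof.
move=> a0 ab b1; rewrite /set_norm /dev scale_set_zero hausdorff_dist_fin //.
  exact/bounded_convexW/Phi_bounded.
exact/bounded_convexW/bounded_convex0.
Qed.

Lemma interval_variation_bound : (interval_variation Phi < +oo)%E ->
  exists V, var_bound V.
Proof.
move=> fin; exists (fine (interval_variation Phi)) => s ps.
have [|s' [r [cs' _ pr]]] := packing_extend
    (Q := xpredT) (d := fun=> 1) (fun t _ _ => ltr01) (fun _ _ _ _ => isT) ler01 ps.
  exact: all_predT.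
have ps' := chain_packing cs'.
apply: (@le_trans _ _ (\sum_(e <- s') dev [set 0] (lo e) (hi e))).
  apply: sum_le_perm pr _ => e /(packing_within ps')/and3P[? /ltW ? ?].
  exact: dev_ge0.
have le : ((\sum_(e <- s') dev [set 0] (lo e) (hi e))%:E <= interval_variation Phi)%E.
  apply: ereal_sup_ubound; exists (size s'), (@seq_itv _ s'); split.
    exact: chain_partition.
  rewrite -sum_seq_itv -sumEFin; apply: eq_bigr => i _.
  have /and3P[? /ltW ? ?] := packing_within ps' (mem_tnth i (in_tuple s')).
  by rewrite /seq_itv /tag_itv set_norm_cc.
rewrite -lee_fin fineK // ge0_fin_numE //; apply: le_trans le.
rewrite lee_fin big_seq sumr_ge0 // => e /(packing_within ps')/and3P[? /ltW ? ?].
exact: dev_ge0.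
Qed.

Lemma var_bound_interval_variation V : var_bound V -> (interval_variation Phi < +oo)%E.
Proof.
move=> vb; apply: (@le_lt_trans _ _ V%:E); last by rewrite ltry.
apply: ge_ereal_sup => _ [p [I [Ip ->]]].
have [l [r [lr Ii ps]]] := partition_packing (fun=> 0) Ip.
rewrite (eq_bigr (fun i => (dev [set 0] (l i) (r i))%:E)); last first.
  by move=> i _; have [? ? ?] := lr i; rewrite Ii set_norm_cc.
rewrite sumEFin lee_fin.
rewrite (sum_partition_packing (t := fun=> 0) (F := fun e => dev [set 0] (lo e) (hi e))).
- exact: vb.
- by move=> i; have [] := lr i.
- move=> i; have [? ? ?] := lr i; apply: dev_diag => //; first by exists 0.
  by rewrite /lo /=; lra.
Qed.

End interval_functions.

(** * Variation of subadditive interval functions *)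

Section variation.
Context {R : realType}.
Implicit Types (e : @tagged R) (s : seq (@tagged R)) (a b c : R).

Lemma packing_map (g : @tagged R -> @tagged R) (q : pred (@tagged R)) a b x y s :
  packing a b s ->
  (forall e, e \in s -> q e -> [/\ x <= lo (g e), lo (g e) < hi (g e) & hi (g e) <= y]) ->
  (forall e, e \in s -> q e -> lo e <= lo (g e) /\ hi (g e) <= hi e) ->
  packing x y [seq g e | e <- s & q e].
Proof.
move=> /andP[_ ps] h1 h2; apply/andP; split.
  apply/allP => f /mapP[e]; rewrite mem_filter => /andP[qe es] ->.
  by have [? ? ?] := h1 e es qe; apply/and3P.
rewrite pairwise_map; apply: (sub_in_pairwise (P := [pred e | (e \in s) && q e])).
- move=> e f /andP[es qe] /andP[fs qf].
  have [le he] := h2 e es qe; have [lf hf] := h2 f fs qf.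
  rewrite /disj => /orP[] h; apply/orP; [left|right].
    exact: le_trans he (le_trans h lf).
  exact: le_trans hf (le_trans h le).
- by apply/allP => e; rewrite mem_filter inE andbC.
- exact: pairwise_filter ps.
Qed.

Context (F : R -> R -> R) (V : R).
Context (F_ge0 : forall a b, 0 <= a -> a <= b -> b <= 1 -> 0 <= F a b).
Context (F_diag : forall a, 0 <= a -> a <= 1 -> F a a = 0).
Context (F_sub : forall a b c, 0 <= a -> a <= b -> b <= c -> c <= 1 ->
  F a c <= F a b + F b c).
Context (F_bound : forall s, packing 0 1 s -> \sum_(e <- s) F (lo e) (hi e) <= V).

Definition var a b : R :=
  sup [set v | exists2 s, packing a b s & v = \sum_(e <- s) F (lo e) (hi e)].

Lemma var_has_sup a b : 0 <= a -> b <= 1 ->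
  has_sup [set v | exists2 s, packing a b s & v = \sum_(e <- s) F (lo e) (hi e)].
Proof.
move=> a0 b1; split; first by exists 0, [::]; rewrite ?big_nil.
exists V => _ [s ps ->]; apply: F_bound; exact: packing_weaken ps.
Qed.

Lemma var_ub a b s : 0 <= a -> b <= 1 -> packing a b s ->
  \sum_(e <- s) F (lo e) (hi e) <= var a b.
Proof.
by move=> a0 b1 ps; apply: ub_le_sup; [have [] := var_has_sup a0 b1|exists s].
Qed.

Lemma var_le a b (M : R) : 0 <= a -> b <= 1 ->
  (forall s, packing a b s -> \sum_(e <- s) F (lo e) (hi e) <= M) -> var a b <= M.
Proof.
move=> a0 b1 h; apply: ge_sup; first by have [] := var_has_sup a0 b1.
by move=> _ [s ps ->]; apply: h.
Qed.

Lemma var_near a b (eta : R) : 0 <= a -> b <= 1 -> 0 < eta ->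
  exists2 s, packing a b s & var a b - eta < \sum_(e <- s) F (lo e) (hi e).
Proof.
move=> a0 b1 eta0; have [_ [s ps ->] lt] := sup_adherent eta0 (var_has_sup a0 b1).
by exists s.
Qed.

Lemma var_ge0 a b : 0 <= a -> b <= 1 -> 0 <= var a b.
Proof.
by move=> a0 b1; have := var_ub a0 b1 (packing_nil a b); rewrite big_nil.
Qed.

Lemma le_var a b : 0 <= a -> a <= b -> b <= 1 -> F a b <= var a b.
Proof.
move=> a0 ab b1; have [-> |nab] := eqVneq a b.
  by rewrite F_diag ?var_ge0 // (le_trans a0).
have lab : a < b by rewrite lt_neqAle nab.
have := @var_ub a b [:: ((a, b), a)] a0 b1.
by rewrite /packing /= /within /lo /hi /= lexx lab lexx big_seq1; apply.
Qed.

Lemma var_superadd a b c : 0 <= a -> a <= b -> b <= c -> c <= 1 ->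
  var a b + var b c <= var a c.
Proof.
move=> a0 ab bc c1; apply/ler_addgt0Pr => eta eta0; have e2 : 0 < eta / 2 by lra.
have [s1 p1 l1] := var_near a0 (le_trans bc c1) e2.
have [s2 p2 l2] := var_near (le_trans a0 ab) c1 e2.
have /(var_ub a0 c1) : packing a c (s1 ++ s2).
  by apply: packing_cat_point p1 p2 _; rewrite ab.
rewrite big_cat /=; lra.
Qed.

(** The interval across b, if any, is cut there, and subadditivity of [F] keeps the sum from
    decreasing. Hence the variation is additive. Tags are carried along and may leave their
    intervals, which a packing permits. *)
Lemma packing_split a b c s : 0 <= a -> a <= b -> b <= c -> c <= 1 -> packing a c s ->
  exists s1 s2, [/\ packing a b s1, packing b c s2 &
    \sum_(e <- s) F (lo e) (hi e) <=
    \sum_(e <- s1) F (lo e) (hi e) + \sum_(e <- s2) F (lo e) (hi e)].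
Proof.
move=> a0 ab bc c1 ps.
pose gl e : @tagged R := ((lo e, Num.min (hi e) b), tg e).
pose gr e : @tagged R := ((Num.max (lo e) b, hi e), tg e).
have pl : packing a b [seq gl e | e <- s & lo e < b].
  apply: (packing_map ps) => e es lb; have /and3P[? ? ?] := packing_within ps es.
    by rewrite /gl /lo /hi /= in lb *; rewrite lt_min ge_min lexx orbT lb; split=> //; apply/andP.
  by rewrite /gl /lo /hi /= ge_min !lexx.
have pr : packing b c [seq gr e | e <- s & b < hi e].
  apply: (packing_map ps) => e es lb; have /and3P[? ? ?] := packing_within ps es.
    by rewrite /gr /lo /hi /= in lb *; rewrite gt_max le_max lexx orbT lb; split=> //; apply/andP.
  by rewrite /gr /lo /hi /= le_max !lexx.
exists [seq gl e | e <- s & lo e < b], [seq gr e | e <- s & b < hi e]; split=> //.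
rewrite !big_map !big_filter [X in _ <= X + _]big_mkcond [X in _ <= _ + X]big_mkcond.
rewrite -big_split /= big_seq [leRHS]big_seq.
apply: ler_sum => e es; have /and3P[aL lh hc] := packing_within ps es.
rewrite /gl /gr /lo /hi /= in aL lh hc *.
case: (ltP e.1.1 b) => h1; case: (ltP b e.1.2) => h2.
- apply: F_sub; [exact: le_trans aL|exact: ltW|exact: ltW|exact: le_trans c1].
- by rewrite addr0.
- by rewrite add0r.
- by have := lt_le_trans lh (le_trans h2 h1); rewrite ltxx.
Qed.

Lemma var_subadd a b c : 0 <= a -> a <= b -> b <= c -> c <= 1 ->
  var a c <= var a b + var b c.
Proof.
move=> a0 ab bc c1; apply: var_le => // s ps.
have [s1 [s2 [p1 p2 le]]] := packing_split a0 ab bc c1 ps.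
have := var_ub a0 (le_trans bc c1) p1; have := var_ub (le_trans a0 ab) c1 p2.
lra.
Qed.

Lemma var_add a b c : 0 <= a -> a <= b -> b <= c -> c <= 1 ->
  var a c = var a b + var b c.
Proof. by move=> *; apply/le_anti; rewrite var_subadd ?var_superadd. Qed.

Lemma var_packing_le a b s : 0 <= a -> a <= b -> b <= 1 -> packing a b s ->
  \sum_(e <- s) var (lo e) (hi e) <= var a b.
Proof.
move=> a0 ab b1; apply: sum_superadditive => //.
- by move=> x y ax xy yb; apply: var_ge0; [exact: le_trans ax|exact: le_trans b1].
- move=> x y z ax xy yz zb.
  by apply: var_superadd => //; [exact: le_trans ax|exact: le_trans b1].
Qed.

Lemma var_diag a : 0 <= a -> a <= 1 -> var a a = 0.
Proof. by move=> a0 a1; have := var_add a0 (lexx a) (lexx a) a1; lra. Qed.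

(* The excess var - F is superadditive, so its sum over intervals refining a
   nearly optimal chain is at most its sum over the chain. *)
Lemma var_excess (eta : R) : 0 < eta -> exists2 d : R -> R, (forall t, 0 < d t) &
  forall s, packing 0 1 s ->
    (forall e, e \in s -> tfine d e /\ (tg e = lo e \/ tg e = hi e)) ->
    \sum_(e <- s) var (lo e) (hi e) <= \sum_(e <- s) F (lo e) (hi e) + eta.
Proof.
move=> eta0; have [P0 pP0 P0n] := var_near (lexx 0) (lexx 1) eta0.
have [|P [r [cP _ pr]]] := packing_extend
    (Q := xpredT) (d := fun=> 1) (fun t _ _ => ltr01) (fun _ _ _ _ => isT) ler01 pP0.
  exact: all_predT.
have pP := chain_packing cP.
have in01 e s : packing 0 1 s -> e \in s -> [/\ 0 <= lo e, lo e < hi e & hi e <= 1].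
  by move=> ps /(packing_within ps)/and3P[].
have Pn : var 0 1 - eta < \sum_(e <- P) F (lo e) (hi e).
  apply: lt_le_trans P0n _; apply: sum_le_perm pr _ => e /(in01 _ _ pP)[? /ltW ? ?].
  exact: F_ge0.
have [d d0 dP] := tfine_avoid ([seq lo e | e <- P] ++ [seq hi e | e <- P]).
exists d => // s ps sP.
pose g x y := var x y - F x y.
suff : \sum_(e <- s) g (lo e) (hi e) <= eta by rewrite /g big_split sumrN /=; lra.
have g0 x y : 0 <= x -> x <= y -> y <= 1 -> 0 <= g x y.
  by move=> *; rewrite subr_ge0 le_var.
have gs x y z : 0 <= x -> x <= y -> y <= z -> z <= 1 -> g x y + g y z <= g x z.
  move=> x0 xy yz z1; have := var_superadd x0 xy yz z1; have := F_sub x0 xy yz z1.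
  by rewrite /g; lra.
apply: (@le_trans _ _ (\sum_(p <- P) g (lo p) (hi p))); last first.
  rewrite /g big_split sumrN /=; have := var_packing_le (lexx 0) ler01 (lexx 1) pP; lra.
apply: le_trans (sum_le_cover (P := P) (rel := fun p e => (lo p <= lo e) && (hi e <= hi p)) _ _) _.
- by move=> e /(in01 _ _ ps)[? /ltW ? ?]; apply: g0.
- move=> e es; have [e0 le e1] := in01 _ _ ps es; have [fe te] := sP e es.
  (* A breakpoint of [P] inside [e] would be its tag, but the tag is an endpoint of [e]. *)
  have avoid x : x \in [seq lo e | e <- P] ++ [seq hi e | e <- P] -> ~~ (lo e < x < hi e).
    move=> xP; apply/negP => /andP[h1 h2].
    have xe : lo e <= x <= hi e by rewrite !ltW.
    by have := dP e x xP fe xe; case: te => ->; lra.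
  have [p pP'|p pP' [h1 h2]] := chain_locate cP e0 le e1.
    by split; apply: avoid; rewrite mem_cat map_f ?orbT.
  by exists p; rewrite // h1.
rewrite big_seq [leRHS]big_seq; apply: ler_sum => p /(in01 _ _ pP)[p0 plh p1].
rewrite -big_filter; apply: sum_superadditive.
- by move=> x y h1 h2 h3; apply: g0; lra.
- by move=> x y z h1 h2 h3 h4; apply: gs; lra.
- exact: ltW.
- by apply: packing_restrict ps _ => e _ /andP[].
Qed.

End variation.

(** * Henstock integrals of finite variation *)

Section gluing.
Context {R : realType}.
Implicit Types (e : @tagged R) (s : seq (@tagged R)).

Lemma sum_by_level (lev : R -> nat) (F : @tagged R -> R) s :
  exists K, \sum_(e <- s) F e = \sum_(k < K) \sum_(e <- s | lev (tg e) == k) F e.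
Proof.
pose K := (\max_(e <- s) lev (tg e)).+1; exists K.
under [RHS]eq_bigr do rewrite big_mkcond.
rewrite exchange_big /= big_seq [RHS]big_seq; apply: eq_bigr => e es.
have lK : (lev (tg e) < K)%N by rewrite ltnS (big_rem e) //= leq_maxl.
rewrite -big_mkcond (big_pred1 (Ordinal lK)) //.
Qed.

(** The gauge at t is taken from the sequence according to the level of t, so each level may have
    its own error budget; the budgets c / 2^k sum to at most 2 c. *)
Lemma glue_levels (lev : R -> nat) (D : nat -> R -> R) (F : @tagged R -> R)
    (P : @tagged R -> Prop) (c : R) : 0 <= c ->
  (forall k s, packing 0 1 s ->
     (forall e, e \in s -> [/\ P e, tfine (D k) e & lev (tg e) = k]) ->
     \sum_(e <- s) F e <= c * (2 ^+ k)^-1) ->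
  forall s, packing 0 1 s ->
    (forall e, e \in s -> P e /\ tfine (fun t => D (lev t) t) e) ->
    \sum_(e <- s) F e <= 2 * c.
Proof.
move=> c0 H s ps sP; have [K ->] := sum_by_level lev F s.
apply: (@le_trans _ _ (\sum_(k < K) c * (2 ^+ k)^-1)).
  apply: ler_sum => k _; rewrite -big_filter; apply: H; first exact: packing_filter.
  move=> e; rewrite mem_filter => /andP[/eqP lk /sP[Pe fe]]; split=> //.
  by move: fe; rewrite /tfine lk.
by rewrite -mulr_sumr mulrC ler_wpM2r // sum_half_pow.
Qed.

End gluing.

Section bounded_variation_integrals.
Context {R : realType} {X : normedModType R}.
Context (Gamma : R -> set X) (Phi : set R -> set X) (V : R).
Context (Gamma_cb : forall t, unit_itv t -> cb (Gamma t)).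
Context (Phi_int : vH_integral Gamma Phi) (Phi_var : var_bound Phi V).
Implicit Types (e : @tagged R) (s : seq (@tagged R)) (C D : set X).

Let Phi_im := proj1 Phi_int.
Let dev := dev Phi.
Let err := err Gamma Phi.
Let zero : set X := [set 0].
Let zero_bc : bounded_convex zero := bounded_convex0.
Let W C : R -> R -> R := var (dev C).
Let hd t C := hdist (Gamma t) C.

Let in01 e s : packing 0 1 s -> e \in s -> [/\ 0 <= lo e, lo e < hi e & hi e <= 1].
Proof. by move=> ps /(packing_within ps)/and3P[]. Qed.

Let perron01 e s : packing 0 1 s -> e \in s -> perron e -> 0 <= tg e <= 1.
Proof.
by move=> ps /(in01 ps)[? ? ?] /andP[? ?]; apply/andP; split; lra.
Qed.

Let Gamma_bc t : 0 <= t <= 1 -> bounded_convex (Gamma t).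
Proof. exact: Gamma_bounded. Qed.

Let hd_ge0 t C : 0 <= t <= 1 -> 0 <= hd t C.
Proof. by move=> /Gamma_bc[? _ _]; apply: hdist_ge0. Qed.

Let devge0 C a b : 0 <= a -> a <= b -> b <= 1 -> 0 <= dev C a b.
Proof. exact: dev_ge0. Qed.

Let dev0 C a : bounded_convex C -> 0 <= a -> a <= 1 -> dev C a a = 0.
Proof. by move=> [? _ _]; apply: dev_diag. Qed.

Let devsub C : bounded_convex C -> forall a b c, 0 <= a -> a <= b -> b <= c -> c <= 1 ->
  dev C a c <= dev C a b + dev C b c.
Proof. by move=> bC a b c; apply: dev_subadd. Qed.

Let dev_bound C : bounded_convex C -> forall s, packing 0 1 s ->
  \sum_(e <- s) dev C (lo e) (hi e) <= V + hdist C zero.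
Proof.
move=> bC s ps.
apply: (@le_trans _ _ (\sum_(e <- s) (dev zero (lo e) (hi e) + len e * hdist C zero))).
  rewrite big_seq [leRHS]big_seq; apply: ler_sum => e /(in01 ps)[? /ltW ? ?].
  exact: dev_le.
rewrite big_split /=; apply: lerD; first exact: Phi_var.
rewrite -mulr_suml ler_piMl //; first by have [? _ _] := bC; apply: hdist_ge0.
by have := sum_len_le ler01 ps; rewrite subr0.
Qed.

Lemma err_le C e : bounded_convex C -> within 0 1 e -> 0 <= tg e <= 1 ->
  err e <= dev C (lo e) (hi e) + len e * hd (tg e) C.
Proof. by move=> bC /and3P[? /ltW ? ?] /Gamma_bc t01; apply: dev_le. Qed.

Lemma dev_le_err C e : bounded_convex C -> within 0 1 e -> 0 <= tg e <= 1 ->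
  dev C (lo e) (hi e) <= err e + len e * hd (tg e) C.
Proof. by move=> bC /and3P[? /ltW ? ?] /Gamma_bc t01; rewrite /hd hdistC; apply: dev_le. Qed.

(* Splitting every interval at its tag reduces to intervals tagged at an
   endpoint, to which var_excess applies. *)
Lemma henstock_var C (eta : R) : bounded_convex C -> 0 < eta ->
  exists2 d : R -> R, (forall t, 0 < d t) &
    forall s, packing 0 1 s -> (forall e, e \in s -> tfine d e /\ perron e) ->
      \sum_(e <- s) W C (lo e) (hi e) <= \sum_(e <- s) hd (tg e) C * len e + eta.
Proof.
move=> bC eta0; have e4 : 0 < eta / 4 by lra.
have [d1 d10 d1P] := henstock_packings Gamma_cb Phi_im Phi_int e4.
have [d2 d20 d2P] := var_excess (@devge0 C) (fun a => @dev0 C a bC) (devsub bC) (dev_bound bC) e4.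
pose d t := Num.min (d1 t) (d2 t).
have fd1 e : tfine d e -> tfine d1 e by apply: tfine_le; rewrite ge_min lexx.
have fd2 e : tfine d e -> tfine d2 e by apply: tfine_le; rewrite ge_min lexx orbT.
exists d => [t|s ps sP]; first by rewrite lt_min d10 d20.
(* Here eta / 4 is the excess of the variation over [dev] and eta / 4 the Henstock error. The left
   and the right halves each use this bound once. *)
have endp s' : packing 0 1 s' ->
    (forall e, e \in s' -> [/\ tfine d e, perron e & tg e = lo e \/ tg e = hi e]) ->
    \sum_(e <- s') W C (lo e) (hi e) <= \sum_(e <- s') hd (tg e) C * len e + eta / 2.
  move=> ps' s'P.
  have h1 : \sum_(e <- s') W C (lo e) (hi e) <=
            \sum_(e <- s') dev C (lo e) (hi e) + eta / 4.
    by apply: d2P => // e /s'P[/fd2].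
  have h2 : \sum_(e <- s') err e <= eta / 4 by apply: d1P => // e /s'P[/fd1].
  have h3 : \sum_(e <- s') dev C (lo e) (hi e) <=
            \sum_(e <- s') err e + \sum_(e <- s') hd (tg e) C * len e.
    rewrite -big_split big_seq [leRHS]big_seq; apply: ler_sum => e es.
    have [_ pe _] := s'P e es; rewrite mulrC; apply: dev_le_err => //.
      exact: packing_within ps' es.
    exact: perron01 ps' es pe.
  lra.
pose gl e : @tagged R := ((lo e, tg e), tg e).
pose gr e : @tagged R := ((tg e, hi e), tg e).
have d0 t : 0 < d t by rewrite lt_min d10 d20.
have pl : packing 0 1 [seq gl e | e <- s & lo e < tg e].
  apply: (packing_map ps) => e es lb; have [h0 h1 h2] := in01 ps es;
    have [_ /andP[h3 h4]] := sP e es; rewrite /gl /lo /hi /= in lb h0 h1 h2 h3 h4 *.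
    by split=> //; apply: le_trans h2.
  by rewrite lexx.
have pr : packing 0 1 [seq gr e | e <- s & tg e < hi e].
  apply: (packing_map ps) => e es lb; have [h0 h1 h2] := in01 ps es;
    have [_ /andP[h3 h4]] := sP e es; rewrite /gr /lo /hi /= in lb h0 h1 h2 h3 h4 *.
    by split=> //; apply: le_trans h3.
  by rewrite lexx.
have hl : \sum_(e <- s | lo e < tg e) W C (lo e) (tg e) <=
    \sum_(e <- s | lo e < tg e) hd (tg e) C * (tg e - lo e) + eta / 2.
  have := endp _ pl; rewrite !big_map !big_filter; apply.
  move=> f /mapP[e]; rewrite mem_filter => /andP[lt es] ->.
  have [/andP[h1 h2] _] := sP e es; have := d0 (tg e).
  rewrite /tfine /perron /gl; rewrite /lo /hi /tg /= in lt h1 h2 * => dt.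
  by split; [rewrite h1 /=; lra|rewrite lexx ltW|right].
have hr : \sum_(e <- s | tg e < hi e) W C (tg e) (hi e) <=
    \sum_(e <- s | tg e < hi e) hd (tg e) C * (hi e - tg e) + eta / 2.
  have := endp _ pr; rewrite !big_map !big_filter; apply.
  move=> f /mapP[e]; rewrite mem_filter => /andP[lt es] ->.
  have [/andP[h1 h2] _] := sP e es; have := d0 (tg e).
  rewrite /tfine /perron /gr; rewrite /lo /hi /tg /= in lt h1 h2 * => dt.
  by split; [rewrite h2 andbT; lra|rewrite lexx ltW|left].
(* Used both for [W C], additive as a variation, and for the length term; a half that degenerates to
   the tag contributes nothing. *)
have split_sum (F : R -> R -> R -> R) :
    (forall e, e \in s -> F (lo e) (hi e) (tg e) =
      F (lo e) (tg e) (tg e) + F (tg e) (hi e) (tg e) /\ F (tg e) (tg e) (tg e) = 0) ->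
    \sum_(e <- s) F (lo e) (hi e) (tg e) =
    \sum_(e <- s | lo e < tg e) F (lo e) (tg e) (tg e) +
    \sum_(e <- s | tg e < hi e) F (tg e) (hi e) (tg e).
  move=> FP; rewrite [X in X + _]big_mkcond [X in _ + X]big_mkcond -big_split /=.
  rewrite big_seq [RHS]big_seq; apply: eq_bigr => e es; have [-> F0] := FP e es.
  have [_ /andP[h3 h4]] := sP e es.
  congr (_ + _); case: ltP => // h.
    by have -> : lo e = tg e by apply/le_anti; rewrite h3 h.
  by have -> : hi e = tg e by apply/le_anti; rewrite h4 h.
have := split_sum (fun x y _ => W C x y); rewrite /= => ->.
  have := split_sum (fun x y t => hd t C * (y - x)); rewrite /len /= => ->; first by lra.
  by move=> e _; split; lra.
move=> e es; have [h0 h1 h2] := in01 ps es; have [_ /andP[h3 h4]] := sP e es.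
have Wadd := var_add (devsub bC) (dev_bound bC).
split; first exact: Wadd.
by apply: (var_diag (devsub bC) (dev_bound bC)); lra.
Qed.

(** All fine intervals tagged at t lie in one interval [a, b] around t, itself fine and Perron for
    the tag t, where [henstock_var] bounds the variation by 3 eta. Their lengths times the norm of
    [Gamma] at t add 2 eta. *)
Lemma sum_err_tag_small (eta : R) : 0 < eta ->
  exists2 d : R -> R, (forall t, 0 < d t) &
    forall t s, 0 <= t <= 1 -> packing 0 1 s -> (forall e, e \in s -> tfine d e) ->
      \sum_(e <- s | tg e == t) err e <= 5 * eta.
Proof.
move=> eta0; have [d1 d10 d1P] := henstock_var zero_bc eta0.
pose d t := Num.min (d1 t) (eta / (`|hd t zero| + 1)).
have hp t : 0 < `|hd t zero| + 1 by rewrite ltr_wpDl.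
have d0 t : 0 < d t by rewrite lt_min d10 divr_gt0.
exists d => // t s t01 ps fs.
have ht := hd_ge0 zero t01; have dt := d0 t.
have hdt : hd t zero * d t <= eta.
  have : d t <= eta / (`|hd t zero| + 1) by rewrite ge_min lexx orbT.
  rewrite ler_pdivlMr // ger0_norm // => le; have : 0 <= d t by exact: ltW.
  by lra.
pose a := Num.max 0 (t - d t); pose b := Num.min 1 (t + d t).
have /andP[t0 t1] := t01.
have a0 : 0 <= a by rewrite le_max lexx.
have b1 : b <= 1 by rewrite ge_min lexx.
have ad : t - d t <= a by rewrite le_max lexx orbT.
have bd : b <= t + d t by rewrite ge_min lexx orbT.
have at_ : a <= t by rewrite ge_max t0; lra.
have tb : t <= b by rewrite le_min t1; lra.
have ab : a < b by rewrite gt_max !lt_min ltr01 /=; apply/and3P; split; lra.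
have pab : packing a b [seq e <- s | tg e == t].
  apply: (packing_restrict ps) => e es /eqP et; have [? ? ?] := in01 ps es.
  have /andP[] := fs e es; rewrite et => ? ?.
  by rewrite ge_max le_min; split; apply/andP; split; lra.
have W1 : W zero a b <= 3 * eta.
  have := d1P [:: ((a, b), t)]; rewrite /packing /= /within !big_seq1 /lo /hi /tg /len /=.
  rewrite a0 ab b1 => /(_ isT) h.
  have : W zero a b <= hd t zero * (b - a) + eta.
    apply: h => e; rewrite inE => /eqP ->; rewrite /tfine /perron /lo /hi /tg /= at_ tb.
    have : d t <= d1 t by rewrite ge_min lexx.
    by split=> //; apply/andP; split; lra.
  have : hd t zero * (b - a) <= hd t zero * (2 * d t) by rewrite ler_wpM2l //; lra.
  lra.
have W2 : \sum_(e <- s | tg e == t) dev zero (lo e) (hi e) <= W zero a b.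
  by rewrite -big_filter; apply: (var_ub (dev_bound zero_bc)).
have L : \sum_(e <- s | tg e == t) len e <= 2 * d t.
  exact: sum_len_tag ps (ltW dt) fs.
apply: (@le_trans _ _ (\sum_(e <- s | tg e == t) (dev zero (lo e) (hi e) + len e * hd t zero))).
  rewrite big_seq_cond [leRHS]big_seq_cond; apply: ler_sum => e /andP[es /eqP et].
  rewrite -et; apply: err_le => //; first exact: packing_within ps es.
  by rewrite et.
rewrite big_split /= -mulr_suml.
have := ler_wpM2r ht L; lra.
Qed.

(* Averages of Phi over rational intervals; Gamma stays away from all of them
   only at a set of tags that carries no mass. *)
Definition rational_average n : set X :=
  if @unpickle (rat * rat)%type n is Some pq then
    if [&& 0 <= ratr pq.1 :> R, ratr pq.1 < ratr pq.2 :> R & ratr pq.2 <= 1 :> R] then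
      scale_set (ratr pq.2 - ratr pq.1)^-1 (Phi `[ratr pq.1, ratr pq.2]%classic)
    else zero
  else zero.

Lemma rational_average_bc n : bounded_convex (rational_average n).
Proof.
rewrite /rational_average; case: unpickle => // pq; case: ifP => // /and3P[h1 h2 h3].
by apply/bounded_convex_scale/Phi_bounded => //; apply: ltW.
Qed.

Definition far (eta t : R) : bool := `[< forall n, eta < hd t (rational_average n) >].

(** The average over [e] itself is one of those from which [Gamma] stays away at the tag. *)
Lemma far_len_le_err (eta : R) e : within 0 1 e -> 0 <= tg e <= 1 -> rational_ends e ->
  far eta (tg e) -> eta * len e <= err e.
Proof.
move=> /and3P[h0 h1 h2] t01 [p [q [lp hq]]] /asboolP/(_ (pickle (p, q))).
rewrite /rational_average pickleK /= -lp -hq h0 h1 h2 /= => lt.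
have l0 : 0 < len e by rewrite subr_gt0.
have bP := bounded_convexW (Phi_bounded Phi_im h0 (ltW h1) h2).
have := hdist_scale_diff l0 (bounded_convexW (Gamma_bc t01)) bP.
rewrite [hdist (scale_set _ _) _]hdistC => /(le_trans _); apply.
by rewrite mulrC ler_pM2l // ltW.
Qed.

(** At far tags of rational intervals, lengths are controlled by Henstock errors. Gluing over the
    integer parts of the norm of [Gamma] bounds the weighted Henstock sums by eps; passing to
    McShane sums then also removes the restriction to rational endpoints. *)
Lemma far_weight_small (eta eps : R) : 0 < eta -> 0 < eps ->
  exists2 d : R -> R, (forall t, 0 < d t) &
    forall s, packing 0 1 s ->
      (forall e, e \in s -> 0 <= tg e <= 1 /\ tfine d e) ->
      \sum_(e <- s) (if far eta (tg e) then hd (tg e) zero else 0) * len e <= 25 * eps.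
Proof.
move=> eta0 eps0.
(* The last factor cancels the loss (k + 1) / eta: norms at level k are below k + 1, and eta times
   the length is at most the error. *)
pose epsk k : R := eps / 2 * (2 ^+ k)^-1 * (eta / k.+1%:R).
have epsk0 k : 0 < epsk k.
  by rewrite !mulr_gt0 ?invr_gt0 ?exprn_gt0 ?ltr0n.
have ex_D k : exists D : R -> R, (forall t, 0 < D t) /\
    forall s, packing 0 1 s -> (forall e, e \in s -> tfine D e /\ perron e) ->
      \sum_(e <- s) err e <= epsk k.
  by have [D ? ?] := henstock_packings Gamma_cb Phi_im Phi_int (epsk0 k); exists D.
have [D DP] := choice ex_D.
pose lev t := Num.truncn (hd t zero).
apply: (@small_henstock_small_mcshane _ (fun t => if far eta t then hd t zero else 0)
  (fun t => D (lev t) t)) => //.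
- by move=> t t01; case: ifP => // _; apply: hd_ge0.
- by move=> t _; case: (DP (lev t)).
move=> s ps sP.
have -> : eps = 2 * (eps / 2) by lra.
apply: (@glue_levels _ lev D _ (fun e => [/\ 0 <= tg e <= 1, perron e & rational_ends e])) ps _.
- by lra.
- move=> k {sP}s ps sP.
  have : \sum_(e <- s) err e <= epsk k.
    by apply: (proj2 (DP k)) => // e /sP[[_ ? _] ? _].
  have k0 : 0 <= k.+1%:R / eta by rewrite divr_ge0 // ltW.
  move=> /(ler_wpM2l k0).
  have -> : k.+1%:R / eta * epsk k = eps / 2 * (2 ^+ k)^-1.
    rewrite /epsk; have : k.+1%:R != 0 :> R by rewrite pnatr_eq0.
    move: (k.+1%:R) => K K0; field.
    by rewrite K0 expf_neq0 //= gt_eqF.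
  apply: le_trans; rewrite mulr_sumr big_seq [leRHS]big_seq; apply: ler_sum => e es.
  have [[t01 pe re] _ lk] := sP e es; have we := packing_within ps es.
  have e0 : 0 <= err e by apply: err_ge0.
  case: ifP => [fe|_]; last by rewrite mul0r mulr_ge0 // err_ge0.
  have := far_len_le_err we t01 re fe.
  move=> le; apply: (@le_trans _ _ (k.+1%:R * len e)).
    rewrite ler_wpM2r //; first by have /and3P[_ /ltW] := we; rewrite subr_ge0.
    by rewrite -lk ltW // Num.Theory.truncnS_gt.
  by rewrite -mulrA ler_wpM2l // mulrC ler_pdivlMr // mulrC.
- move=> e es; have [/andP[/ltW t0 /ltW t1] fe pe re] := sP e es.
  by split=> //; rewrite t0 t1.
Qed.

(* Up to variation 4 eps, Phi is the primitive of the step function D: the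
   tag of each interval of a fine partition selects a rational average. *)
Lemma step_approximation (eps : R) : 0 < eps ->
  exists J (D : @tagged R -> set X), [/\ chain 0 J 1, forall j, bounded_convex (D j) &
    \sum_(j <- J) W (D j) (lo j) (hi j) <= 4 * eps].
Proof.
move=> eps0.
(* Level 0 collects the far tags and is given the set {0}; level n + 1 is given the n-th average,
   within eps of [Gamma]. *)
have ex_lev t : exists k : nat, if far eps t then k = 0%N
    else exists2 n, k = n.+1 & hd t (rational_average n) <= eps.
  have [_|/asboolPn/existsNP[n /negP]] := boolP (far eps t); first by exists 0%N.
  by rewrite -leNgt => h; exists n.+1, n.
have [lev levP] := choice ex_lev.
pose C k := if k is n.+1 then rational_average n else zero.
have bC k : bounded_convex (C k) by case: k => //= n; exact: rational_average_bc.
have epsk0 k : 0 < eps * (2 ^+ k)^-1 by rewrite mulr_gt0 ?invr_gt0 ?exprn_gt0.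
have ex_d k : exists d : R -> R, (forall t, 0 < d t) /\
    forall s, packing 0 1 s -> (forall e, e \in s -> tfine d e /\ perron e) ->
      \sum_(e <- s) W (C k) (lo e) (hi e) <=
      \sum_(e <- s) hd (tg e) (C k) * len e + eps * (2 ^+ k)^-1.
  by have [d ? ?] := henstock_var (bC k) (epsk0 k); exists d.
have [d1 d1P] := choice ex_d.
have e25 : 0 < eps / 25 by lra.
have [d2 d20 d2P] := far_weight_small eps0 e25.
pose d t := Num.min (d1 (lev t) t) (d2 t).
have d0 t : 0 <= t -> t <= 1 -> 0 < d t.
  by move=> _ _; rewrite lt_min d20 (proj1 (d1P (lev t))).
have [J cJ fJ] := cousin d0 ler01.
have pJ := chain_packing cJ.
have JP e : e \in J -> [/\ tfine (fun t => d1 (lev t) t) e, tfine d2 e, perron e & 0 <= tg e <= 1].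
  move=> eJ; have /andP[fe pe] := allP fJ e eJ.
  split=> //; last exact: perron01 pJ eJ pe.
    by apply: tfine_le fe; rewrite ge_min lexx.
  by apply: tfine_le fe; rewrite ge_min lexx orbT.
exists J, (fun j => C (lev (tg j))); split=> //.
(* Gluing the gauges of [henstock_var] costs 2 eps. The remaining distances cost eps at the near
   tags and 25 (eps / 25) at the far ones. *)
have h1 : \sum_(e <- J) (W (C (lev (tg e))) (lo e) (hi e) - hd (tg e) (C (lev (tg e))) * len e)
    <= 2 * eps.
  apply: (@glue_levels _ lev d1 _ perron _ (ltW eps0)) pJ _.
    move=> k s ps sP; rewrite big_split sumrN /= lerBlDl.
    have -> : \sum_(e <- s) W (C (lev (tg e))) (lo e) (hi e) = \sum_(e <- s) W (C k) (lo e) (hi e).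
      by rewrite big_seq [RHS]big_seq; apply: eq_bigr => e /sP[_ _ ->].
    have -> : \sum_(e <- s) hd (tg e) (C (lev (tg e))) * len e =
              \sum_(e <- s) hd (tg e) (C k) * len e.
      by rewrite big_seq [RHS]big_seq; apply: eq_bigr => e /sP[_ _ ->].
    by apply: (proj2 (d1P k)) => // e /sP[].
  by move=> e /JP[].
have h2 : \sum_(e <- J) hd (tg e) (C (lev (tg e))) * len e <=
    \sum_(e <- J) (if far eps (tg e) then hd (tg e) zero else 0) * len e + eps.
  apply: (@le_trans _ _ (\sum_(e <- J)
      ((if far eps (tg e) then hd (tg e) zero else 0) * len e + eps * len e))).
    rewrite big_seq [leRHS]big_seq; apply: ler_sum => e eJ.
    have l0 : 0 <= len e by have [_ /ltW] := in01 pJ eJ; rewrite subr_ge0.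
    have := levP (tg e); case: ifP => [_ -> /=|_ [n -> /= h]].
      by rewrite lerDl mulr_ge0 // ltW.
    by rewrite mul0r add0r ler_wpM2r.
  rewrite big_split /= lerD2l -mulr_sumr ger_pMr //.
  by have := sum_len_le ler01 pJ; rewrite subr0.
have h3 := d2P J pJ (fun e eJ => let: And4 _ f _ t := JP e eJ in conj t f).
move: h1; rewrite big_split sumrN /=; lra.
Qed.

(* h is the distance from Gamma to the step function D away from the
   breakpoints of J, which are handled separately. *)
Lemma henstock_small_mcshane_sums : small_mcshane_sums Gamma Phi.
Proof.
(* Breakpoint tags will cost eps and the other tags 4 eps + 125 eps, which stays below 131 eps. *)
move=> eps' eps'0; pose eps := eps' / 131.
have eps0 : 0 < eps by rewrite divr_gt0.
have [J [D [cJ bD WJ]]] := step_approximation eps0.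
have pJ := chain_packing cJ.
pose B := [seq lo j | j <- J] ++ [seq hi j | j <- J].
pose inside (t : R) j := lo j < t < hi j.
pose jt t := nth ((0, 0), 0) J (find (inside t) J).
pose h t := if has (inside t) J then hd t (D (jt t)) else 0.
have jtP t : has (inside t) J -> jt t \in J /\ inside t (jt t).
  by move=> ht; split; [rewrite mem_nth // -has_find|exact: nth_find].
have [dB dB0 dBP] := tfine_avoid B.
have sub e : tfine dB e -> has (inside (tg e)) J ->
    lo (jt (tg e)) <= lo e /\ hi e <= hi (jt (tg e)).
  move=> /andP[f1 f2] /jtP[jJ /andP[lt th]]; have dt := dB0 (tg e).
  (* The whole gauge neighbourhood of the tag is itself a fine interval, so it misses every other
     breakpoint. This confines [e] to the link of its tag even when the tag lies outside [e]. *)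
  have out b : b \in B -> b != tg e -> ~~ (tg e - dB (tg e) <= b <= tg e + dB (tg e)).
    move=> bB bt; apply/negP => hb; move/eqP: bt; apply.
    apply: (dBP ((tg e - dB (tg e), tg e + dB (tg e)), tg e) b bB _ hb).
    by rewrite /tfine /lo /hi /tg /= !lexx.
  have := out (lo (jt (tg e))); rewrite mem_cat map_f // lt_eqF // => /(_ isT isT).
  have := out (hi (jt (tg e))); rewrite mem_cat map_f ?orbT // gt_eqF // => /(_ isT isT).
  by rewrite !negb_and -!ltNge => /orP[] ? /orP[] ?; split; lra.
have dev_step s : packing 0 1 s -> (forall e, e \in s -> tfine dB e) ->
    \sum_(e <- s | has (inside (tg e)) J) dev (D (jt (tg e))) (lo e) (hi e) <= 4 * eps.
  move=> ps fs; rewrite -big_filter.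
  have ps' : packing 0 1 [seq e <- s | has (inside (tg e)) J] by exact: packing_filter.
  apply: le_trans (sum_le_cover (P := J) (rel := fun j e => jt (tg e) == j) _ _) _.
  - move=> e /(in01 ps')[? /ltW ? ?]; exact: devge0.
  - move=> e; rewrite mem_filter => /andP[he _]; exists (jt (tg e)) => //.
    by case: (jtP _ he).
  apply: le_trans WJ; rewrite big_seq [leRHS]big_seq; apply: ler_sum => j jJ.
  have [j0 jlh j1] := in01 pJ jJ.
  have -> : \sum_(e <- [seq e <- s | has (inside (tg e)) J] | jt (tg e) == j)
     dev (D (jt (tg e))) (lo e) (hi e) =
     \sum_(e <- [seq e <- [seq e <- s | has (inside (tg e)) J] | jt (tg e) == j])
     dev (D j) (lo e) (hi e).
    by rewrite big_filter; apply: eq_bigr => e /eqP ->.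
  apply: (var_ub (dev_bound (bD j))) => //.
  apply: (packing_restrict ps') => e es /eqP <-.
  move: (es); rewrite mem_filter => /andP[he ins].
  exact: sub (fs _ ins) he.
have [dH dH0 dHP] := henstock_packings Gamma_cb Phi_im Phi_int eps0.
have e5 : 0 < 5 * eps by lra.
have h0 t : 0 <= t <= 1 -> 0 <= h t.
  by move=> t01; rewrite /h; case: ifP => // _; apply: hd_ge0.
(* By [hdist_le_dev], h times the length is at most the Henstock error plus the deviation from [D],
   that is eps + 4 eps in total. *)
have hs s : packing 0 1 s ->
    (forall e, e \in s -> [/\ 0 < tg e < 1, tfine (fun t => Num.min (dB t) (dH t)) e,
       perron e & rational_ends e]) -> \sum_(e <- s) h (tg e) * len e <= 5 * eps.
  move=> ps sP.
  have fB e : e \in s -> tfine dB e.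
    by move=> /sP[_ fe _ _]; apply: tfine_le fe; rewrite ge_min lexx.
  have fH e : e \in s -> tfine dH e /\ perron e.
    by move=> /sP[_ fe pe _]; split=> //; apply: tfine_le fe; rewrite ge_min lexx orbT.
  have h1 := dHP s ps fH; have h2 := dev_step s ps fB.
  have -> : 5 * eps = eps + 4 * eps by lra.
  apply: le_trans (lerD h1 h2); rewrite [X in _ + X]big_mkcond -big_split /=.
  rewrite big_seq [leRHS]big_seq; apply: ler_sum => e es.
  have we := packing_within ps es; have [_ _ pe _] := sP e es.
  have t01 := perron01 ps es pe.
  rewrite /h; case: ifP => _; last by rewrite mul0r addr0 err_ge0.
  by rewrite mulrC; have /and3P[? ? ?] := we; apply: hdist_le_dev => //; apply: Gamma_bc.
have dm0 t : 0 < t < 1 -> 0 < Num.min (dB t) (dH t) by rewrite lt_min dB0 dH0.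
have [dG dG0 dGP] := small_henstock_small_mcshane e5 h0 dm0 hs.
pose U := undup B.
(* The budget eps is shared among the breakpoints; the 5 offsets the constant of
   [sum_err_tag_small], and the successor keeps the denominator positive. *)
have etaU : 0 < eps / (5 * (size U).+1%:R) by rewrite divr_gt0 // mulr_gt0 // ltr0n.
have [dT dT0 dTP] := sum_err_tag_small etaU.
exists (fun t => Num.min (dB t) (Num.min (dG t) (dT t))).
  by move=> t; rewrite !lt_min dB0 dG0 dT0.
move=> s ps sP.
have fB e : e \in s -> tfine dB e.
  by move=> /sP[fe _]; apply: tfine_le fe; rewrite ge_min lexx.
have fG e : e \in s -> 0 <= tg e <= 1 /\ tfine dG e.
  by move=> /sP[fe t01]; split=> //; apply: tfine_le fe; rewrite !ge_min lexx orbT.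
have fT e : e \in s -> tfine dT e.
  by move=> /sP[fe t01]; apply: tfine_le fe; rewrite !ge_min lexx !orbT.
have B01 b : b \in B -> 0 <= b <= 1.
  by rewrite mem_cat => /orP[] /mapP[j /(in01 pJ)[? ? ?] ->]; apply/andP; split; lra.
have brk : \sum_(e <- s | ~~ has (inside (tg e)) J) err e <= eps.
  rewrite -big_filter.
  have ps' : packing 0 1 [seq e <- s | ~~ has (inside (tg e)) J] by exact: packing_filter.
  apply: le_trans (sum_le_cover (P := U) (rel := fun b e => tg e == b) _ _) _.
  - by move=> e /(packing_within ps'); apply: err_ge0.
  - move=> e; rewrite mem_filter => /andP[/hasPn nh /sP[_ t01]].
    exists (tg e) => //; rewrite mem_undup mem_cat.
    have [j jJ /andP[h1 h2]] := chain_cover cJ ltr01 t01.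
    have := nh j jJ; rewrite /inside negb_and -!leNgt => /orP[] h3.
      by rewrite (_ : tg e = lo j) ?map_f //; apply/le_anti; rewrite h1 h3.
    by rewrite (_ : tg e = hi j) ?map_f ?orbT //; apply/le_anti; rewrite h2 h3.
  apply: (@le_trans _ _ (\sum_(b <- U) eps / (size U).+1%:R)).
    rewrite big_seq [leRHS]big_seq; apply: ler_sum => b; rewrite mem_undup => bB.
    have -> : eps / (size U).+1%:R = 5 * (eps / (5 * (size U).+1%:R)).
      by rewrite invfM; have : 5 != 0 :> R by []; move=> ?; field.
    apply: dTP => //; first exact: B01.
    by move=> e; rewrite mem_filter => /andP[_ /fT].
  rewrite big_const_seq count_predT iter_addr_0 -[_ *+ _]mulr_natr mulrAC.
  by rewrite ler_pdivrMr ?ltr0n // ler_pM2l // ler_nat.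
have ins : \sum_(e <- s | has (inside (tg e)) J) err e <= 4 * eps + 25 * (5 * eps).
  apply: le_trans (lerD (dev_step s ps fB) (dGP s ps fG)).
  rewrite big_mkcond [X in _ <= X + _]big_mkcond -big_split /=.
  rewrite big_seq [leRHS]big_seq; apply: ler_sum => e es.
  have we := packing_within ps es; have [_ t01] := sP e es.
  rewrite /h; case: ifP => _; last by rewrite mul0r addr0.
  by rewrite [_ * len e]mulrC; apply: err_le.
rewrite (bigID (fun e => has (inside (tg e)) J)) /=.
have epsE : eps' = 131 * eps by rewrite /eps; lra.
lra.
Qed.

End bounded_variation_integrals.

(** * Variation of a McShane integral *)

Section refinements.
Context {R : realType}.
Implicit Types (e : @tagged R) (s : seq (@tagged R)) (d : R -> R).
Context (F : R -> R -> R).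
Context (F_diag : forall a, 0 <= a -> a <= 1 -> F a a = 0).
Context (F_sub : forall a b c, 0 <= a -> a <= b -> b <= c -> c <= 1 ->
  F a c <= F a b + F b c).

(* Retagging the pieces by the tags of J is what makes them McShane fine. *)
Lemma packing_refine_chain J a b s : 0 <= a -> b <= 1 -> chain a J b -> packing a b s ->
  exists r, [/\ packing a b r,
    \sum_(e <- s) F (lo e) (hi e) <= \sum_(e <- r) F (lo e) (hi e) &
    forall e, e \in r -> exists2 j, j \in J & [/\ tg e = tg j, lo j <= lo e & hi e <= hi j]].
Proof.
elim: J a s => [|j J IH] a s a0 b1 /=.
  move=> /eqP -> ps; exists s; split=> // e /(packing_within ps)/and3P[h1 h2 h3].
  by have := le_lt_trans h1 (lt_le_trans h2 h3); rewrite ltxx.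
move=> /and3P[/eqP ja lh cJ] ps; rewrite ja in lh.
have hb := chain_le cJ.
have [s1 [s2 [p1 p2 le]]] := packing_split F_sub a0 (ltW lh) hb b1 ps.
have [r [pr ler rP]] := IH (hi j) s2 (le_trans a0 (ltW lh)) b1 cJ p2.
exists ([seq ((lo e, hi e), tg j) | e <- s1] ++ r); split.
- apply: packing_cat_point (pr) _; last by rewrite ltW.
  have := @packing_map _ (fun e => ((lo e, hi e), tg j)) xpredT _ _ a (hi j) _ p1.
  rewrite filter_predT; apply=> e es _; last by rewrite /lo /hi /= !lexx.
  by have /and3P[] := packing_within p1 es.
- by rewrite big_cat big_map; apply: le_trans le _; rewrite lerD2l.
- move=> e; rewrite mem_cat => /orP[/mapP[f fs ->]|/rP[i iJ h]].
    exists j; rewrite ?mem_head // ja; have /and3P[? _ ?] := packing_within p1 fs.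
    by split.
  by exists i; rewrite // inE iJ orbT.
Qed.

(** Each interval is replaced by a fine Perron chain tiling it, and subadditivity keeps the sum from
    decreasing. *)
Lemma packing_refine_fine d s : (forall t, 0 < d t) -> packing 0 1 s ->
  exists r, [/\ packing 0 1 r,
    \sum_(e <- s) F (lo e) (hi e) <= \sum_(e <- r) F (lo e) (hi e) &
    forall e, e \in r -> tfine d e /\ perron e].
Proof.
move=> d0 /(packing_fam ler01)[s' ps fs]; rewrite (sum_perm _ ps).
suff H a : 0 <= a -> fam a s' 1 -> exists r, [/\ packing a 1 r,
    \sum_(e <- s') F (lo e) (hi e) <= \sum_(e <- r) F (lo e) (hi e) &
    forall e, e \in r -> tfine d e /\ perron e] by exact: H.
elim: s' a {s ps fs} => [|e s IH] a a0 /=; first by exists [::].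
move=> /and3P[ae lh fs].
have h0 : 0 <= hi e by rewrite (le_trans a0) // (le_trans ae) // ltW.
have hb := fam_le fs.
have [r [pr le rP]] := IH _ h0 fs.
have [c cc fc] := cousin (fun t _ _ => d0 t) (ltW lh).
exists (c ++ r); split.
- apply: packing_cat_point (pr) _; last by rewrite hb (le_trans ae (ltW lh)).
  by apply: packing_weaken (chain_packing cc).
- rewrite big_cons big_cat; apply: lerD => //.
  apply: sum_subadditive cc.
    by move=> x y z h1 h2 h3 h4; apply: F_sub; lra.
  by move=> x h1 h2; rewrite F_diag //; lra.
- by move=> f; rewrite mem_cat => /orP[fc'|/rP//]; have /andP[] := allP fc f fc'.
Qed.

End refinements.

Section mcshane_variation.
Context {R : realType} {X : normedModType R}.
Context (Gamma : R -> set X).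
Context (Gamma_cb : forall t, unit_itv t -> cb (Gamma t)).
Implicit Types (e : @tagged R) (s : seq (@tagged R)) (Phi : set R -> set X).

Lemma vM_vH_integral Phi : vM_integral Gamma Phi -> vH_integral Gamma Phi.
Proof.
move=> [im vM]; split=> // eps /vM[d [gd dP]]; exists d; split=> // p I t [tp _].
exact: dP.
Qed.

(** With [sum_norm_le] this compares the variation sums of an integral with the sums of the norms of
    [Gamma], in both directions up to the error. The latter sums link two different integrals. *)
Lemma sum_dev0_le Phi s : interval_multimeasure Phi -> packing 0 1 s ->
  (forall e, e \in s -> 0 <= tg e <= 1) ->
  \sum_(e <- s) dev Phi [set 0] (lo e) (hi e) <=
  \sum_(e <- s) err Gamma Phi e + \sum_(e <- s) len e * hdist (Gamma (tg e)) [set 0].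
Proof.
move=> im ps ts; rewrite -big_split big_seq [leRHS]big_seq; apply: ler_sum => e es.
have /and3P[? /ltW ? ?] := packing_within ps es.
rewrite /= hdistC; apply: dev_le => //; first exact: bounded_convex0.
exact: Gamma_bounded (ts e es).
Qed.

Lemma sum_norm_le Phi s : interval_multimeasure Phi -> packing 0 1 s ->
  (forall e, e \in s -> 0 <= tg e <= 1) ->
  \sum_(e <- s) len e * hdist (Gamma (tg e)) [set 0] <=
  \sum_(e <- s) err Gamma Phi e + \sum_(e <- s) dev Phi [set 0] (lo e) (hi e).
Proof.
move=> im ps ts; rewrite -big_split big_seq [leRHS]big_seq; apply: ler_sum => e es.
have /and3P[? ? ?] := packing_within ps es.
apply: hdist_le_dev => //; last exact: bounded_convex0.
exact: Gamma_bounded (ts e es).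
Qed.

Lemma vM_var_bound Phi : vM_integral Gamma Phi -> exists V, var_bound Phi V.
Proof.
move=> vM; have im := proj1 vM.
have [d d0 dP] := mcshane_packings Gamma_cb im vM ltr01.
have [J cJ fJ] := cousin (fun t _ _ => d0 t) ler01.
have pJ := chain_packing cJ.
have J01 j : j \in J -> 0 <= tg j <= 1.
  move=> jJ; have /and3P[? ? ?] := packing_within pJ jJ.
  by have /andP[_ /andP[? ?]] := allP fJ j jJ; apply/andP; split; lra.
have g0 t : 0 <= t <= 1 -> 0 <= hdist (Gamma t) [set 0].
  by move=> /(Gamma_bounded Gamma_cb)[? _ _]; apply: hdist_ge0.
(* A crude common bound for the norms of [Gamma] at the tags of [J]. *)
pose M := \sum_(j <- J) hdist (Gamma (tg j)) [set 0].
have M0 : 0 <= M by rewrite /M big_seq sumr_ge0 // => j /J01/g0.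
exists (1 + M) => s ps.
have bc0 : bounded_convex [set (0 : X)] := bounded_convex0.
have devsub a b c : 0 <= a -> a <= b -> b <= c -> c <= 1 ->
  dev Phi [set 0] a c <= dev Phi [set 0] a b + dev Phi [set 0] b c by apply: dev_subadd.
have [r [pr le rP]] := packing_refine_chain devsub (lexx 0) (lexx 1) cJ ps.
have r01 e : e \in r -> 0 <= tg e <= 1 by move=> /rP[j /J01 ? [->]].
apply: le_trans le _; apply: le_trans (sum_dev0_le im pr r01) _; apply: lerD.
  apply: dP => // e er; split; last exact: r01.
  have [j jJ [tj lj hj]] := rP e er.
  have /andP[/andP[h1 h2] _] := allP fJ j jJ.
  by rewrite /tfine tj; apply/andP; split; lra.
apply: (@le_trans _ _ (\sum_(e <- r) len e * M)).
  rewrite big_seq [leRHS]big_seq; apply: ler_sum => e er.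
  have /and3P[_ /ltW lh _] := packing_within pr er.
  rewrite ler_wpM2l ?subr_ge0 //; have [j jJ [-> _ _]] := rP e er.
  rewrite /M (big_rem j) //= lerDl big_seq sumr_ge0 // => i /mem_rem/J01.
  exact: g0.
rewrite -mulr_suml ler_piMl //.
by have := sum_len_le ler01 pr; rewrite subr0.
Qed.

(** No uniqueness of the integral is invoked. On a packing refined to be fine for both integrals,
    passing from [Psi] to the norms of [Gamma] and on to [Phi] costs an error of 1 each, hence 2 +
    V. *)
Lemma vM_vH_variation Phi Psi : vM_integral Gamma Phi -> vH_integral Gamma Psi ->
  (interval_variation Psi < +oo)%E.
Proof.
move=> vM vH; have [imM imH] := (proj1 vM, proj1 vH).
have [V VP] := vM_var_bound vM.
have [d1 d10 d1P] := mcshane_packings Gamma_cb imM vM ltr01.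
have [d2 d20 d2P] := henstock_packings Gamma_cb imH vH ltr01.
apply: (var_bound_interval_variation imH (V := 2 + V)) => s ps.
have bc0 : bounded_convex [set (0 : X)] := bounded_convex0.
have devdiag a : 0 <= a -> a <= 1 -> dev Psi [set 0] a a = 0.
  by apply: dev_diag => //; exists 0.
have devsub a b c : 0 <= a -> a <= b -> b <= c -> c <= 1 ->
  dev Psi [set 0] a c <= dev Psi [set 0] a b + dev Psi [set 0] b c by apply: dev_subadd.
have d0 t : 0 < Num.min (d1 t) (d2 t) by rewrite lt_min d10 d20.
have [r [pr le rP]] := packing_refine_fine devdiag devsub d0 ps.
have r01 e : e \in r -> 0 <= tg e <= 1.
  move=> er; have /and3P[? ? ?] := packing_within pr er.
  by have [_ /andP[? ?]] := rP e er; apply/andP; split; lra.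
have h1 := sum_dev0_le imH pr r01; have h2 := sum_norm_le imM pr r01.
have h3 := VP r pr.
have h4 : \sum_(e <- r) err Gamma Phi e <= 1.
  apply: d1P => // e er; split; last exact: r01.
  by have [fe _] := rP e er; apply: tfine_le fe; rewrite ge_min lexx.
have h5 : \sum_(e <- r) err Gamma Psi e <= 1.
  apply: d2P => // e er; have [fe pe] := rP e er; split=> //.
  by apply: tfine_le fe; rewrite ge_min lexx orbT.
lra.
Qed.

End mcshane_variation.

Theorem theorem3p5 (R : realType) (X : completeNormedModType R)
    (Gamma : R -> set X)
    (Gamma_cb : forall t : R, unit_itv t -> cb (Gamma t)) :
  vM_integrable Gamma <->
  (vH_integrable Gamma /\
   forall Phi : set R -> set X,
     vH_integral Gamma Phi -> (interval_variation Phi < +oo)%E).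
Proof.
split=> [[Phi vM]|[[Phi vH] fin]].
  split; first by exists Phi; apply: vM_vH_integral.
  by move=> Psi; apply: vM_vH_variation vM.
(* The given Henstock integral is itself shown to be a McShane integral. *)
exists Phi; have im := proj1 vH.
have [V VP] := interval_variation_bound im (fin Phi vH).
apply: vM_integral_packings => //.
exact: henstock_small_mcshane_sums vH VP.
Qed.
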